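(* Let $n,p$ be integers with $p>n\ge 3$. Let $X\sim N_p(\theta,\Sigma)$ with unknown mean $\theta\in\mathbb{R}^p$ and unknown positive definite covariance matrix $\Sigma$, and let $S\sim \mathrm{Wishart}_p(n,\Sigma)$ be independent of $X$. For $a\in\mathbb{R}$, the James--Stein-like estimator $$\delta^{\mathrm{JS}}_a(X,S)=\left(I-\frac{a\,SS^+}{X'S^+X}\right)X$$ dominates $\delta^0(X,S)=X$ under the invariant quadratic loss $L(\theta,\delta)=(\delta-\theta)'\Sigma^{-1}(\delta-\theta)$ for all $$0\le a\le \frac{2(n-2)}{p-n+3}.$$
   Context: $M'$ denotes the transpose and $M^+$ the Moore--Penrose pseudo-inverse of a matrix $M$; $I$ is the $p\times p$ identity matrix. $S\sim\mathrm{Wishart}_p(n,\Sigma)$ means that $S=Y'Y$ for an $n\times p$ random matrix $Y\sim N_{n\times p}(0,I_n\otimes\Sigma)$, i.e. the rows of $Y$ are i.i.d. $N_p(0,\Sigma)$; for $p>n$ the matrix $S$ is almost surely singular. The estimator $\delta^{\mathrm{JS}}_a$ is defined almost surely (where $X'S^+X\neq 0$). The risk of an estimator $\delta(X,S)$ at $(\theta,\Sigma)$ is $E_{\theta}[(\delta(X,S)-\theta)'\Sigma^{-1}(\delta(X,S)-\theta)]$, the expectation being over $(X,S)$. ''$\delta^{\mathrm{JS}}_a$ dominates $\delta^0$'' means that the risk of $\delta^{\mathrm{JS}}_a$ is less than or equal to the risk of $\delta^0$ for every $\theta$ (and every positive definite $\Sigma$). *)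

(* Defs.v *)
From HB Require Import structures.
From mathcomp Require Import all_boot all_order all_algebra.
From mathcomp Require Import all_classical all_reals all_analysis.

Set Implicit Arguments.
Unset Strict Implicit.
Unset Printing Implicit Defensive.

Import Order.TTheory GRing.Theory Num.Theory.
Import numFieldNormedType.Exports.

Local Open Scope classical_set_scope.
Local Open Scope ring_scope.

Section linear_algebra.
Variable R : realFieldType.

Definition posdefmx p (M : 'M[R]_p) : Prop :=
  M^T = M /\ forall u : 'cV[R]_p, u != 0 -> 0 < (u^T *m M *m u) 0 0.

(* The four Penrose equations. *)
Definition is_mpinv m n (M : 'M[R]_(m, n)) (N : 'M[R]_(n, m)) : Prop :=
  [/\ M *m N *m M = M, N *m M *m N = N,
      (M *m N)^T = M *m N & (N *m M)^T = N *m M].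

(* The default value 0 is never used, see mpinvP. *)
Definition mpinv m n (M : 'M[R]_(m, n)) : 'M[R]_(n, m) :=
  xget 0 [set N | is_mpinv M N].

Lemma is_mpinv_unique m n (M : 'M[R]_(m, n)) N N' :
  is_mpinv M N -> is_mpinv M N' -> N = N'.
Proof.
move=> [h1 h2 h3 h4] [k1 k2 k3 k4].
have e1 : M *m N = M *m N'.
  by rewrite -h3 -{1}k1 -mulmxA trmx_mul h3 k3 !mulmxA h1.
have e2 : N *m M = N' *m M.
  rewrite -h4 -{1}k1 mulmxA [N *m _]mulmxA -(mulmxA (N *m M)).
  by rewrite trmx_mul h4 k4 -!mulmxA [M *m (N *m M)]mulmxA h1.
by rewrite -h2 e2 -mulmxA e1 mulmxA k2.
Qed.

Lemma gram_unitmx m r (C : 'M[R]_(m, r)) : \rank C = r -> C^T *m C \in unitmx.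
Proof.
move=> rC; rewrite -row_free_unit; apply/inj_row_free => v vCC.
have fC : row_free C^T by rewrite /row_free mxrank_tr rC.
apply/eqP; rewrite -(mulmx_free_eq0 _ fC).
have : v *m C^T *m (v *m C^T)^T = 0.
  by rewrite trmx_mul trmxK mulmxA -(mulmxA v) vCC mul0mx.
move: (v *m C^T) => w /matrixP/(_ 0 0); rewrite !mxE => /eqP; rewrite psumr_eq0 => [/allP w0|k _]; last first.
  by rewrite mxE -expr2 sqr_ge0.
apply/eqP/matrixP => i j; rewrite [i]ord1 [RHS]mxE.
have := w0 j (mem_index_enum _) => /=.
by rewrite [_^T _ _]mxE -expr2 sqrf_eq0 => /eqP.
Qed.

Lemma is_mpinv_full_rank m n r (C : 'M[R]_(m, r)) (F : 'M[R]_(r, n)) :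
  \rank C = r -> \rank F = r ->
  is_mpinv (C *m F)
    (F^T *m invmx (F *m F^T) *m invmx (C^T *m C) *m C^T).
Proof.
move=> rC rF; have uC := gram_unitmx rC.
have uF : F *m F^T \in unitmx.
  by rewrite -{1}(trmxK F); apply: gram_unitmx; rewrite mxrank_tr.
move GE : (invmx (C^T *m C)) => G; move HE : (invmx (F *m F^T)) => H.
have GC : G *m (C^T *m C) = 1%:M by rewrite -GE mulVmx.
have FH : F *m F^T *m H = 1%:M by rewrite -HE mulmxV.
have tG : G^T = G by rewrite -GE trmx_inv trmx_mul trmxK.
have tH : H^T = H by rewrite -HE trmx_inv trmx_mul trmxK.
have MN : C *m F *m (F^T *m H *m G *m C^T) = C *m G *m C^T.
  by rewrite !mulmxA -(mulmxA C F) -(mulmxA C _ H) FH mulmx1.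
have NM : F^T *m H *m G *m C^T *m (C *m F) = F^T *m H *m F.
  by rewrite !mulmxA -(mulmxA _ C^T) -(mulmxA _ G) GC mulmx1.
split.
- by rewrite MN !mulmxA -(mulmxA _ C^T) -(mulmxA _ G) GC mulmx1.
- by rewrite NM !mulmxA -(mulmxA _ F) -(mulmxA _ (F *m F^T)) FH mulmx1.
- by rewrite MN !trmx_mul trmxK tG mulmxA.
- by rewrite NM !trmx_mul trmxK tH mulmxA.
Qed.

Lemma is_mpinv_exists m n (M : 'M[R]_(m, n)) : exists N, is_mpinv M N.
Proof.
rewrite -[M]mulmx_base; eexists; apply: is_mpinv_full_rank.
  by apply/eqP; have := col_base_full M; rewrite /row_full.
by apply/eqP; have := row_base_free M; rewrite /row_free.
Qed.

Lemma mpinvP m n (M : 'M[R]_(m, n)) : is_mpinv M (mpinv M).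
Proof.
by have [N MN] := is_mpinv_exists M; exact: (xgetPex 0 (ex_intro _ N MN)).
Qed.

End linear_algebra.

(* Matrices carry the sigma-algebra generated by their entries, i.e. the Borel
   sigma-algebra of R^(m * n). *)
Definition measure_mx_display : measure_display.
Proof. exact. Qed.

Section measurable_matrix.
Variables (R : realType) (m n : nat).

Definition mx_cylinders : set (set 'M[R]_(m, n)) :=
  [set A | exists i j (B : set R),
     measurable B /\ A = [set M : 'M[R]_(m, n) | B (M i j)]].

Let mx_set0 : <<s mx_cylinders >> set0.
Proof. exact: sigma_algebra0. Qed.

Let mx_setC A : <<s mx_cylinders >> A -> <<s mx_cylinders >> (~` A).
Proof. exact: sigma_algebraC. Qed.

Let mx_bigcup (F : (set 'M[R]_(m, n))^nat) :
  (forall i, <<s mx_cylinders >> (F i)) ->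
  <<s mx_cylinders >> (\bigcup_i F i).
Proof. exact: sigma_algebra_bigcup. Qed.

HB.instance Definition _ := @isMeasurable.Build measure_mx_display
  'M[R]_(m, n) <<s mx_cylinders >> mx_set0 mx_setC mx_bigcup.

End measurable_matrix.

Section independence.
Context {d : measure_display} {T : measurableType d} {R : realType}.
Variable P : probability T R.

(* The product rule for subfamilies is the case where some B i are setT. *)
Definition mutually_independent {d'} {T' : measurableType d'} {I : finType}
    (X : I -> T -> T') : Prop :=
  forall B : I -> set T', (forall i, measurable (B i)) ->
    P [set w | forall i, B i (X i w)] = (\prod_(i : I) P (X i @^-1` B i))%E.

Definition independent {d1 d2} {T1 : measurableType d1}
    {T2 : measurableType d2} (X : T -> T1) (Y : T -> T2) : Prop :=
  forall A B, measurable A -> measurable B ->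
    P (X @^-1` A `&` Y @^-1` B) = (P (X @^-1` A) * P (Y @^-1` B))%E.

End independence.

Section gaussian.
Context {d : measure_display} {T : measurableType d} {R : realType}.
Variable P : probability T R.

(* The entries of Z are i.i.d. N(0, 1). *)
Definition std_normal p (Z : {RV P >-> 'cV[R]_p}) : Prop :=
  (forall (i : 'I_p) (B : set R), measurable B ->
     P [set w | B (Z w i 0)] = normal_prob 0 1 B) /\
  mutually_independent P (fun (i : 'I_p) w => Z w i 0).

(* X ~ N_p(theta, Sigma) for an invertible Sigma. Then A is invertible, so Z is
   determined by X, and asking for Z on the same probability space is a
   condition on the distribution of X only. *)
Definition multinormal p (X : T -> 'cV[R]_p) (theta : 'cV[R]_p)
    (Sigma : 'M[R]_p) : Prop :=
  exists (A : 'M[R]_p) (Z : {RV P >-> 'cV[R]_p}),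
    [/\ A *m A^T = Sigma, std_normal Z & forall w, X w = theta + A *m Z w].

(* Y ~ N_{n x p}(0, I_n (x) Sigma): the rows are i.i.d. N_p(0, Sigma). *)
Definition normal_rows n p (Y : T -> 'M[R]_(n, p)) (Sigma : 'M[R]_p) : Prop :=
  (forall i, multinormal (fun w => (row i (Y w))^T) 0 Sigma) /\
  mutually_independent P (fun (i : 'I_n) w => (row i (Y w))^T).

End gaussian.

(* S has the distribution of Y'Y; Y may live on another probability space. *)
Definition wishart {d} {T : measurableType d} {R : realType}
    (P : probability T R) (n p : nat) (S : T -> 'M[R]_p)
    (Sigma : 'M[R]_p) : Prop :=
  exists d' (T' : measurableType d') (P' : probability T' R)
    (Y : {RV P' >-> 'M[R]_(n, p)}),
    normal_rows P' Y Sigma /\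
    forall B : set 'M[R]_p, measurable B ->
      P (S @^-1` B) = P' [set w | B ((Y w)^T *m Y w)].

Section estimation.
Variables (R : realType) (p : nat).

Definition loss (Sigma : 'M[R]_p) (theta delta : 'cV[R]_p) : R :=
  ((delta - theta)^T *m invmx Sigma *m (delta - theta)) 0 0.

(* The loss is nonnegative for Sigma positive definite, so that the risk is a
   well-defined element of [0, +oo]. *)
Definition risk d (T : measurableType d) (P : probability T R)
    (X : T -> 'cV[R]_p) (S : T -> 'M[R]_p) (theta : 'cV[R]_p)
    (Sigma : 'M[R]_p) (delta : 'cV[R]_p -> 'M[R]_p -> 'cV[R]_p) : \bar R :=
  'E_P[fun w => loss Sigma theta (delta (X w) (S w))].

Definition delta0 (X : 'cV[R]_p) (S : 'M[R]_p) : 'cV[R]_p := X.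

(* When X' S^+ X = 0, division by zero makes deltaJS a X S equal to X. *)
Definition deltaJS (a : R) (X : 'cV[R]_p) (S : 'M[R]_p) : 'cV[R]_p :=
  (1%:M - (a / (X^T *m mpinv S *m X) 0 0) *: (S *m mpinv S)) *m X.

(* delta dominates delta' based on independent X ~ N_p(theta, Sigma) and
   S ~ Wishart_p(n, Sigma), theta and Sigma being unknown. *)
Definition dominates (n : nat)
    (delta delta' : 'cV[R]_p -> 'M[R]_p -> 'cV[R]_p) : Prop :=
  forall (theta : 'cV[R]_p) (Sigma : 'M[R]_p), posdefmx Sigma ->
  forall (d : measure_display) (T : measurableType d) (P : probability T R)
    (X : {RV P >-> 'cV[R]_p}) (S : {RV P >-> 'M[R]_p}),
    multinormal P X theta Sigma -> wishart P n S Sigma -> independent P X S ->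
    (risk P X S theta Sigma delta <= risk P X S theta Sigma delta')%E.

End estimation.

(* Main.v *)
Require Import Defs.
From HB Require Import structures.
From mathcomp Require Import all_boot all_order all_algebra.
From mathcomp Require Import all_classical all_reals all_analysis.
From mathcomp Require Import measurable_realfun.
From mathcomp Require Import ring lra.

Set Implicit Arguments.
Unset Strict Implicit.
Unset Printing Implicit Defensive.

Import Order.TTheory GRing.Theory Num.Theory.
Import numFieldNormedType.Exports.

Local Open Scope classical_set_scope.
Local Open Scope ring_scope.

(** Write [S = Y' Y], where the [n] rows of [Y] are independent N_p(0, Sigma).
    With [W = (Y^+)' X], [v = Y' W] and [q = |W|^2] one has [X' S^+ X = q] and
    [S S^+ X = v], and the loss of the James-Stein estimator minus that of [X] is

      - 2 a (X - theta)' Sigma^-1 v / q + a^2 v' Sigma^-1 v / q^2.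

    Gaussian integration by parts turns both terms into divergences.  In [X], for
    fixed [Y], the first expectation is that of [(n - 2) / q]; in the rows of [Y],
    for fixed [X], the second one is that of [(p - n + 3) / q].  The difference
    of the risks is thus [a (a (p - n + 3) - 2 (n - 2)) E(1 / q)], which is
    nonpositive for the given [a].

    The fields [v / q] and [W_i v / q^2] are singular where [q = 0] and where
    [Y Y'] is singular.  They are replaced by bounded smooth ones: [W] becomes
    [(Y Y' + de I)^-1 Y X] and [1 / q] becomes [c = 1 / (q + ep)].  Both identities
    then become inequalities in the favourable direction, up to a multiple of
    [de * m * c], where [m] is the sum of the absolute values of the entries of
    [M = (Y Y' + de I)^-1] ([tr_shrink_jac_ge], [sum_tr_quad_jac_le]).  To
    see that this error vanishes with [de], integrate by parts once more, with the
    fields [Y' M e_i]: their divergence contains [de tr(M^2)] and its expectation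
    is bounded uniformly in [de], so that [E(de * m)] is of order the square root
    of [de] ([expected_tikabs_le]).

    The regularised estimators therefore have a risk at most that of [X], up to an
    error that vanishes ([risk_tik_le]).  They converge at every point to the
    James-Stein estimator, first as [de] and then as [ep] tends to 0, since
    [(Y Y' + de I)^-1 Y] tends to [(Y^+)'] for every matrix [Y] ([tik_cvg]); as the
    losses are nonnegative, Fatou's lemma passes to the limit, even if
    [E(1 / q)] is infinite. *)

(** * Integration by parts for the standard normal law *)

Section stein_1d.
Context {R : realType}.
Local Notation mu := (@lebesgue_measure R).
Local Notation phi := (@normal_pdf R 0 1).

(** The density of the normal law is a Radon-Nikodym derivative, and such
    derivatives are unique almost everywhere. *)
Lemma integral_normal_prob (f : R -> \bar R) :
  (normal_prob (0:R) 1).-integrable setT f ->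
  (\int[normal_prob (0:R) 1]_x f x = \int[mu]_x (f x * (phi x)%:E))%E.
Proof.
move=> intf; have mf := measurable_int _ intf.
rewrite -(Radon_Nikodym_change_of_variables (normal_prob_dominates (0:R) 1))//=.
apply: ae_eq_integral => //.
- apply: emeasurable_funM => //; apply: (measurable_int mu).
  apply: (integrableS _ _ (@subsetT _ _)) => //=.
  by apply: Radon_Nikodym_integrable; exact: normal_prob_dominates.
- apply: emeasurable_funM => //=; apply/measurable_EFinP.
  exact: measurable_normal_pdf.
- apply: ae_eqe_mul2l => /=.
  rewrite Radon_NikodymE//=; first exact: normal_prob_dominates.
  move=> abmu.
  case: cid => /= h [h1 h2 h3].
  apply: integral_ae_eq => //=.
  + by apply/measurable_EFinP; exact: measurable_normal_pdf.
  + by move=> E E01 mE; rewrite -h3.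
Qed.

Lemma normal_pdf01E (x : R) : phi x = normal_peak 1 * expR (- (x ^+ 2 / 2)).
Proof.
rewrite normal_pdfE ?oner_eq0// /normal_fun subr0 expr1n.
by congr (_ * expR _); rewrite mulNr.
Qed.

Lemma normal_pdf02E (x : R) :
  normal_pdf 0 2 x = normal_peak 2 * expR (- (x ^+ 2 / 8)).
Proof.
rewrite normal_pdfE ?pnatr_eq0// /normal_fun subr0 mulNr.
by congr (_ * expR (- _)); congr (_ / _); lra.
Qed.

(** The first moment is controlled by a normal density of larger variance, whose
    integral is known to be finite. *)
Lemma abs_normal_pdf_le (x : R) :
  `|x| * phi x <= 2 * normal_peak 1 / normal_peak 2 * normal_pdf 0 2 x.
Proof.
rewrite normal_pdf01E normal_pdf02E.
have p1 : 0 < normal_peak (1:R) by rewrite normal_peak_gt0// oner_eq0.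
have p2 : 0 < normal_peak (2:R) by rewrite normal_peak_gt0// pnatr_eq0.
rewrite (_ : - (x ^+ 2 / 2) = - (x ^+ 2 / 8) + - (3 * x ^+ 2 / 8)); last by field.
rewrite expRD; set E := expR (- (x ^+ 2 / 8)).
have E0 : 0 < E := expR_gt0 _.
have -> : 2 * normal_peak 1 / normal_peak 2 * (normal_peak 2 * E) =
   normal_peak 1 * E * 2 by field; rewrite gt_eqF.
have -> : `|x| * (normal_peak 1 * (E * expR (- (3 * x ^+ 2 / 8)))) =
  normal_peak 1 * E * (`|x| * expR (- (3 * x ^+ 2 / 8))) by ring.
rewrite ler_pM2l ?mulr_gt0// expRN -ler_pdivlMr ?invr_gt0 ?expR_gt0// invrK.
have h := expR_ge1Dx (3 * x ^+ 2 / 8).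
have : x ^+ 2 = `|x| ^+ 2 by rewrite real_normK ?num_real.
have := normr_ge0 x; move: (expR _) h (`|x|) => e h y y0 xy.
have : 0 <= (y - 1) ^+ 2 := sqr_ge0 _.
rewrite xy in h; nra.
Qed.

Lemma integrable_abs_normal_pdf :
  mu.-integrable setT (fun x : R => (`|x| * phi x)%:E).
Proof.
apply: (@le_integrable _ _ _ mu setT measurableT _ (fun x => (2 * normal_peak 1 / normal_peak 2)%:E * (normal_pdf 0 2 x)%:E)%E).
- apply/measurable_EFinP; apply: measurable_funM => //.
  exact: measurable_normal_pdf.
- move=> x _; rewrite -EFinM !abse_EFin lee_fin ger0_norm.
    by rewrite (le_trans (abs_normal_pdf_le x))// ler_norm.
  by rewrite mulr_ge0// normal_pdf_ge0.
- by apply: integrableZl => //; exact: integrable_normal_pdf.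
Qed.

Import HBNNSimple.
(** Simple functions are bounded, hence integrable, so that
    [integral_normal_prob] applies to them; monotone convergence does the rest. *)
Lemma ge0_integral_normal_prob (f : R -> \bar R) :
  measurable_fun setT f -> (forall x, 0 <= f x)%E ->
  (\int[normal_prob (0:R) 1]_x f x = \int[mu]_x (f x * (phi x)%:E))%E.
Proof.
move=> mf f0.
pose g n := [the {nnsfun _ >-> _} of nnsfun_approx measurableT mf n].
have gf x : (g n x)%:E @[n --> \oo] --> f x by exact: cvg_nnsfun_approx.
have mg n : measurable_fun setT (fun x => (g n x)%:E) by exact/measurable_EFinP.
have ndg x : {homo (fun n => g n x) : m n / (m <= n)%N >-> m <= n}.
  by move=> m n mn; exact/lefP/nd_nnsfun_approx.
transitivity (limn (fun n => \int[normal_prob (0:R) 1]_x (g n x)%:E)%E).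
  rewrite -monotone_convergence//.
  - by apply: eq_integral => x _; apply/esym/cvg_lim.
  - by move=> n x _; rewrite lee_fin.
  - by move=> x _ m n mn; rewrite lee_fin; exact: ndg.
transitivity (limn (fun n => \int[mu]_x ((g n x)%:E * (phi x)%:E))%E); last first.
  rewrite -monotone_convergence//.
  - apply: eq_integral => x _; apply/cvg_lim => //; apply: cvgeZr => //.
  - move=> n; apply: emeasurable_funM; first exact: mg.
    by apply/measurable_EFinP; exact: measurable_normal_pdf.
  - by move=> n x _; rewrite mule_ge0 ?lee_fin ?normal_pdf_ge0.
  - move=> x _ m n mn; rewrite lee_wpmul2r ?lee_fin ?normal_pdf_ge0//.
    exact: ndg.
apply: congr_lim; apply/funext => n; apply: integral_normal_prob.
apply: measurable_bounded_integrable => //.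
  by rewrite (le_lt_trans (probability_le1 _ _)) ?ltry.
  by have /measurable_EFinP := mg n.
have [M [Mr gM]] := simple_bounded (g n).
by exists M; split => // x Mx z _; exact: gM.
Qed.

Lemma integrable_normal_prob_id :
  (normal_prob (0:R) 1).-integrable setT (fun x : R => x%:E).
Proof.
apply/integrableP; split; first exact/measurable_EFinP.
rewrite ge0_integral_normal_prob//; last first.
  by apply: measurableT_comp.
have /integrableP[_] := integrable_abs_normal_pdf.
apply: le_lt_trans; apply: ge0_le_integral => //.
- by move=> x _; rewrite mule_ge0// lee_fin normal_pdf_ge0.
- apply: emeasurable_funM; first exact: measurableT_comp.
  by apply/measurable_EFinP; exact: measurable_normal_pdf.
- by have /integrableP[mf _] := integrable_abs_normal_pdf; apply: measurableT_comp.
- by move=> x _; rewrite abse_EFin -EFinM abse_EFin lee_fin ler_norm.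
Qed.

Lemma cvg_normal_pdf01 : phi n%:R @[n --> \oo] --> (0:R).
Proof.
apply: (@squeeze_cvgr _ _ _ _ (fun=> 0) (fun n => normal_peak 1 * 2 * n.+1%:R^-1)).
- near=> n; apply/andP; split; first exact: normal_pdf_ge0.
  rewrite normal_pdf01E -mulrA.
  rewrite ler_wpM2l ?normal_peak_ge0// expRN -[2 / _]invf_div lef_pV2 ?posrE ?expR_gt0//.
  rewrite (le_trans _ (expR_ge1Dx _))// -natr1.
  have : 0 <= (n%:R - 1) ^+ 2 :> R := sqr_ge0 _.
  have : 0 <= n%:R :> R by [].
  by move: (n%:R) => y; nra.
- exact: cvg_cst.
- rewrite -[X in _ --> X](mulr0 (normal_peak 1 * 2)).
  by apply: cvgMr; exact: cvg_harmonic.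
Unshelve. all: end_near. Qed.

End stein_1d.

Section stein_1d_identity.
Context {R : realType}.
Local Notation mu := (@lebesgue_measure R).
Local Notation phi := (@normal_pdf R 0 1).

Lemma is_derive_normal_pdf01 (x : R) : is_derive x 1 phi (- (x * phi x)).
Proof.
have -> : phi = (fun x => normal_peak 1 * expR (- (x ^+ 2 / 2))).
  by apply/funext => y; exact: normal_pdf01E.
have d1 : is_derive x 1 (fun x : R => - (x ^+ 2 / 2)) (- x).
  rewrite (_ : (fun x => _) = (fun x : R => (- 2^-1 : R) *: (x ^+ 2))); last first.
    by apply/funext => y; rewrite /GRing.scale/= mulNr mulrC.
  apply: is_derive_eq.
  by rewrite /GRing.scale /=; field.
have d2 := @is_derive1_comp _ expR (fun x => - (x ^+ 2 / 2)) x _ _ (is_derive_expR _) d1.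
have d3 : is_derive x 1 (fun x : R => normal_peak 1 *: expR (- (x ^+ 2 / 2)))
   (normal_peak 1 *: (expR (- (x ^+ 2 / 2)) * - x)).
  exact: is_deriveZ d2.
apply: is_derive_eq d3 _.
by rewrite /GRing.scale /=; ring.
Qed.

Lemma is_derive_continuous (f : R -> R) (x df : R) : is_derive x 1 f df ->
  {for x, continuous f}.
Proof. by move=> h; apply: differentiable_continuous; apply/derivable1_diffP. Qed.

Lemma continuous_FTC (F f : R -> R) (a b : R) : a < b ->
  (forall x : R, is_derive x 1 F (f x)) -> continuous f ->
  (\int[mu]_(x in `[a, b]) (f x)%:E = (F b - F a)%:E)%E.
Proof.
move=> ab dF cf; rewrite EFinB; apply: continuous_FTC2 => //.
- exact: continuous_subspaceT.
- split.
  + by move=> x _.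
  + by apply: cvg_at_right_filter; apply: is_derive_continuous (dF _).
  + by apply: cvg_at_left_filter; apply: is_derive_continuous (dF _).
- by move=> x _; rewrite derive1E; apply: derive_val.
Qed.

(** The integral over [[-k, k]] is [F k - F (- k)]. *)
Lemma integral_derive_eq0 (F f : R -> R) :
  (forall x : R, is_derive x 1 F (f x)) -> continuous f ->
  mu.-integrable setT (EFin \o f) ->
  F n%:R @[n --> \oo] --> (0:R) -> F (- n%:R) @[n --> \oo] --> (0:R) ->
  (\int[mu]_x (f x)%:E = 0)%E.
Proof.
move=> dF cf intf F0 FN0.
pose f_ n := ((EFin \o f) \_ (`[(- n.+1%:R)%R, n.+1%:R%R] : set R))%E.
have mf : measurable_fun setT f by exact: continuous_measurable_fun.
have mf_ n : measurable_fun setT (f_ n).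
  apply/(measurable_restrict _ _ _) => //; apply: measurable_funTS.
  exact/measurable_EFinP.
have [|||||_ _ cvf] := @dominated_convergence _ _ _ mu setT measurableT f_
  (EFin \o f) (abse \o (EFin \o f)).
- exact: mf_.
- exact: measurable_int intf.
- apply: aeW => x _; apply: cvg_near_cst; near=> n.
  rewrite /f_ patchE ifT// inE/= in_itv/= -ler_norml -natr1 ler_wpDr//.
  by near: n; exact: nbhs_infty_ger.
- exact: integrable_abse.
- apply: aeW => x n _; rewrite /f_ patchE; case: ifP => // _.
  by rewrite (_ : point = 0%E)// abse0 abse_ge0.
apply: cvg_unique cvf _ => //=.
rewrite (_ : (fun _ => _) = (fun n => (F n.+1%:R - F (- n.+1%:R))%:E)); last first.
  apply/funext => n; rewrite -(continuous_FTC _ dF cf); last first.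
    by rewrite gtrN// ltr0n.
  by rewrite [RHS]integral_mkcond.
apply: cvg_EFin; first exact: nearW.
rewrite /= -[X in _ --> X](subr0 0); apply: cvgB.
  by rewrite -(cvg_shiftS (fun n => F n%:R)) in F0.
by rewrite -(cvg_shiftS (fun n => F (- n%:R))) in FN0.
Unshelve. all: end_near. Qed.

(** The derivative of [- f * phi] is [(x * f - f') * phi], and [f * phi] vanishes at
    infinity because [f] is bounded. *)
Lemma stein_normal_prob (f f' : R -> R) (C : R) :
  (forall x : R, is_derive x 1 f (f' x)) -> continuous f' ->
  (forall x, `|f x| <= C) -> (forall x, `|f' x| <= C) ->
  (\int[normal_prob (0:R) 1]_x (x * f x)%:E = \int[normal_prob (0:R) 1]_x (f' x)%:E)%E.
Proof.
move=> df cf' fC f'C.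
have cf : continuous f by move=> x; exact: is_derive_continuous (df x).
have mf : measurable_fun setT f by exact: continuous_measurable_fun.
have mf' : measurable_fun setT f' by exact: continuous_measurable_fun.
pose N := normal_prob (0:R) 1.
have i1 : N.-integrable setT (fun x => (x * f x)%:E).
  apply: (@le_integrable _ _ _ N setT measurableT _ (fun x => C%:E * x%:E)%E).
  - by apply/measurable_EFinP; apply: measurable_funM.
  - move=> x _; rewrite -EFinM !abse_EFin lee_fin !normrM mulrC.
    by rewrite ler_wpM2r// (le_trans (fC x))// ler_norm.
  - by apply: integrableZl => //; exact: integrable_normal_prob_id.
have i2 : N.-integrable setT (fun x => (f' x)%:E).
  apply: measurable_bounded_integrable => //.
    by rewrite (le_lt_trans (probability_le1 _ _)) ?ltry.
  exists C; split; rewrite ?num_real// => y Cy x _ /=.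
  by rewrite (le_trans (f'C x))// ltW.
have B2 := integrable_fin_num measurableT i2.
rewrite -[LHS](subeK _ B2) -[RHS]add0e; congr (_ + _)%E.
rewrite -integralB//=.
have bnd (u : nat -> R) : (forall n, `|u n| = n%:R) ->
    - (f (u n) * phi (u n)) @[n --> \oo] --> (0:R).
  move=> un.
  have phiE n : phi (u n) = phi n%:R.
    rewrite !normal_pdf01E -(@real_normK _ (u n)) ?num_real// un //.
  apply: (@squeeze_cvgr _ _ _ _ (fun n => - (C * phi n%:R)) (fun n => C * phi n%:R)).
  - apply: nearW => n; rewrite -ler_norml normrN normrM phiE.
    rewrite [X in _ * X]ger0_norm ?ler_wpM2r//; exact: normal_pdf_ge0.
  - rewrite -[X in _ --> X]oppr0 -[X in _ --> - X](mulr0 C).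
    by apply: cvgN; apply: cvgMr; exact: cvg_normal_pdf01.
  - rewrite -[X in _ --> X](mulr0 C).
    by apply: cvgMr; exact: cvg_normal_pdf01.
have i3 : N.-integrable setT (fun x => (x * f x)%:E - (f' x)%:E)%E.
  exact: integrableB.
rewrite -/N integral_normal_prob//.
pose k x := (x * f x - f' x) * phi x.
transitivity (\int[mu]_x (k x)%:E)%E.
  by apply: eq_integral => x _; rewrite /k -EFinB -EFinM.
have ck : continuous k.
  have cphi : continuous phi by apply: continuous_normal_pdf; rewrite oner_eq0.
  move=> x; apply: cvgM; last exact: cphi.
  apply: cvgB; last exact: cf'.
  by apply: cvgM; [exact: cvg_id|exact: cf].
apply: (@integral_derive_eq0 (fun x => - (f x * phi x)) k).
- move=> x; have d := is_deriveN (is_deriveM (df x) (is_derive_normal_pdf01 x)).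
  by apply: is_derive_eq d _; rewrite /k /GRing.scale/=; ring.
- exact: ck.
- have cst_int := integrable_abs_normal_pdf.
  apply: (@le_integrable _ _ _ mu setT measurableT _
    (fun x : R => C%:E * (`|x| * phi x)%:E + C%:E * (phi x)%:E)%E).
  + by apply/measurable_EFinP; exact: continuous_measurable_fun.
  + move=> x _; rewrite -!EFinM -EFinD !abse_EFin lee_fin -mulrDr.
    have p0 : 0 <= phi x by exact: normal_pdf_ge0.
    rewrite [leRHS]ger0_norm; last first.
      by rewrite mulr_ge0// ?addr_ge0// ?mulr_ge0// (le_trans _ (fC 0)).
    rewrite /k normrM (ger0_norm p0) [leRHS](_ : _ = C * (`|x| + 1) * phi x); last by ring.
    rewrite ler_wpM2r// mulrDr mulr1 (le_trans (ler_normB _ _))// normrM mulrC.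
    by rewrite lerD// ler_wpM2r.
  + apply: integrableD => //; apply: integrableZl => //.
    exact: integrable_normal_pdf.
- by apply: (bnd (fun n => n%:R)) => n; rewrite normr_nat.
- by apply: (bnd (fun n => - n%:R)) => n; rewrite normrN normr_nat.
Qed.

End stein_1d_identity.

(** * Independence and iterated integrals *)

Section independence_theory.
Context {R : realType} {d : measure_display} {T : measurableType d}.
Variable P : probability T R.

Section pair.
Context {d1 d2 : measure_display} {T1 : measurableType d1} {T2 : measurableType d2}.
Variables (U : T -> T1) (V : T -> T2).
Hypotheses (mU : measurable_fun setT U) (mV : measurable_fun setT V).
Hypothesis UV : independent P U V.
Variables (m1 : probability T1 R) (m2 : probability T2 R).
Hypothesis Um1 : forall A, measurable A -> P (U @^-1` A) = m1 A.
Hypothesis Vm2 : forall B, measurable B -> P (V @^-1` B) = m2 B.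

Let mUV : measurable_fun setT (fun w => (U w, V w)).
Proof. exact: measurable_fun_pair. Qed.

Let UV_mixin := isMeasurableFun.Build _ _ _ _ _ mUV.
Let UV_pack : {mfun T >-> (T1 * T2)%type} := HB.pack (fun w => (U w, V w)) UV_mixin.

Let pairE (A : set (T1 * T2)) : measurable A ->
  (m1 \x m2)%E A = distribution P UV_pack A.
Proof.
move=> mA; apply: product_measure_unique => // B C mB mC.
rewrite /distribution /pushforward /=.
by rewrite -Um1// -Vm2// -UV.
Qed.

(** The joint law of independent maps is the product of their laws, by uniqueness
    on rectangles. *)
Lemma ge0_integral_indep (f : T1 * T2 -> \bar R) :
  measurable_fun setT f -> (forall z, 0 <= f z)%E ->
  (\int[P]_w f (U w, V w) = \int[(m1 \x m2)%E]_z f z)%E.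
Proof.
move=> mf f0.
rewrite (eq_measure_integral (distribution P UV_pack)); last first.
  by move=> A mA _; exact: pairE.
by rewrite ge0_integral_distribution.
Qed.

Lemma integrable_indep (f : T1 * T2 -> \bar R) :
  measurable_fun setT f -> P.-integrable setT (fun w => f (U w, V w)) ->
  (m1 \x m2)%E.-integrable setT f.
Proof.
move=> mf /integrableP[mfUV lty]; apply/integrableP; split => //.
rewrite -ge0_integral_indep//.
exact: measurableT_comp.
Qed.

Lemma integral_indep (f : T1 * T2 -> \bar R) :
  measurable_fun setT f -> P.-integrable setT (fun w => f (U w, V w)) ->
  (\int[P]_w f (U w, V w) = \int[m2]_y \int[m1]_x f (x, y))%E.
Proof.
move=> mf fi; have ii := integrable_indep mf fi.
transitivity (\int[(m1 \x m2)%E]_z f z)%E; last first.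
  by rewrite -integral21_prod_meas1.
rewrite [RHS](eq_measure_integral (distribution P UV_pack)); last first.
  by move=> A mA _; exact: pairE.
by rewrite integral_distribution.
Qed.

End pair.

Section rest.
Context {d' : measure_display} {T' : measurableType d'} {I : finType}.
Variables (X : I -> T -> T') (i0 : I).
Hypothesis mX : forall i, measurable_fun setT (X i).
Hypothesis indX : mutually_independent P X.

(** A pi-system that generates the events depending on the coordinates other than
    [i0]. *)
Definition rest_events : set (set T) := [set E | exists B : I -> set T',
  (forall i, measurable (B i)) /\ E = [set w | forall i, i != i0 -> B i (X i w)]].

Lemma rest_eventsI : setI_closed rest_events.
Proof.
move=> _ _ [B [mB ->]] [C [mC ->]]; exists (fun i => B i `&` C i); split.
  by move=> i; exact: measurableI.
apply/seteqP; split => w /=; first by move=> [h1 h2] i ii0; split; [exact: h1|exact: h2].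
by move=> h; split => i /h[].
Qed.

Lemma rest_events_measurable : rest_events `<=` measurable.
Proof.
move=> _ [B [mB ->]].
rewrite (_ : [set w | _] = \bigcap_(i in [set i | i != i0]) (X i @^-1` (B i))); last first.
  by apply/seteqP; split => w /= h i /h.
apply: fin_bigcap_measurable; first exact: finite_finset.
by move=> i _; rewrite -[X in measurable X]setTI; exact: mX.
Qed.

(** In [E], both sides are finite measures, and they agree on a generating
    pi-system. *)
Lemma indep_rest_events A E : measurable A -> <<s rest_events >> E ->
  P (X i0 @^-1` A `&` E) = (P (X i0 @^-1` A) * P E)%E.
Proof.
move=> mA sE.
have mXA : measurable (X i0 @^-1` A).
  by rewrite -[X in measurable X]setTI; exact: mX.
have sm : <<s rest_events >> `<=` measurable.
  by apply: smallest_sub; [exact: sigma_algebra_measurable|exact: rest_events_measurable].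
have fPA : P (X i0 @^-1` A) \is a fin_num by exact: fin_num_measure.
pose r := NngNum (fine_ge0 (measure_ge0 P (X i0 @^-1` A))).
have rE : (r%:num%:E = P (X i0 @^-1` A))%E by rewrite /= fineK.
rewrite -rE setIC -[LHS]/(mrestr P mXA E).
rewrite -[RHS]/(mscale r P E).
apply: (g_sigma_algebra_measure_unique rest_events rest_events_measurable
  (fun=> setT)) => //.
- move=> _; exists (fun=> setT); split => //.
  by apply/seteqP.
- by rewrite bigcup_const.
- exact: rest_eventsI.
- move=> _ [B [mB ->]].
  set E' := [set w | forall i, i != i0 -> B i (X i w)].
  suff : P (E' `&` X i0 @^-1` A) = (r%:num%:E * P E')%E by [].
  rewrite rE /E'.
  pose B0 i := if i == i0 then A else B i.
  pose B1 i := if i == i0 then setT else B i.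
  have mB0 i : measurable (B0 i) by rewrite /B0; case: ifP.
  have mB1 i : measurable (B1 i) by rewrite /B1; case: ifP.
  have e0 : [set w | forall i, B0 i (X i w)] =
      [set w | forall i, i != i0 -> B i (X i w)] `&` X i0 @^-1` A.
    apply/seteqP; split => w /=.
      move=> h; split => [i ii0|]; last by have := h i0; rewrite /B0 eqxx.
      by have := h i; rewrite /B0 (negbTE ii0).
    by move=> [h hA] i; rewrite /B0; case: eqVneq => [->//|]; exact: h.
  have e1 : [set w | forall i, B1 i (X i w)] =
      [set w | forall i, i != i0 -> B i (X i w)].
    apply/seteqP; split => w /=.
      by move=> h i ii0; have := h i; rewrite /B1 (negbTE ii0).
    by move=> h i; rewrite /B1; case: eqVneq => [->//|]; exact: h.
  rewrite -e0 -e1 indX// indX// (bigD1 i0)//= [in RHS](bigD1 i0)//=.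
  rewrite {1}/B0 {1}/B1 !eqxx preimage_setT probability_setT mul1e.
  congr (_ * _)%E; apply: eq_bigr => i ii0.
  by rewrite /B0 /B1 (negbTE ii0).
- move=> k; suff : (P (setT `&` X i0 @^-1` A) < +oo)%E by [].
  by rewrite setTI -ge0_fin_numE.
Qed.

(** This covers the matrix obtained by erasing one entry or one row of a random
    matrix: an erased entry is constant, and any other one is a function of a single
    member of the family. *)
Lemma independent_rest {m k : nat} (V : T -> 'M[R]_(m, k)) :
  (forall a b, exists (i : I) (f : T' -> R), [/\ measurable_fun setT f,
     (forall w, V w a b = f (X i w)) & i = i0 -> exists r, forall w, V w a b = r]) ->
  independent P (X i0) V.
Proof.
move=> hV A B mA mB; apply: indep_rest_events => //.
suff : <<s @mx_cylinders R m k >> `<=` [set B | <<s rest_events >> (V @^-1` B)] by exact.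
apply: smallest_sub.
  split => [|C sC|F sF] /=.
  - by rewrite preimage_set0; exact: sigma_algebra0.
  - by rewrite setTD preimage_setC; exact: sigma_algebraC.
  - by rewrite preimage_bigcup; exact: sigma_algebra_bigcup.
move=> _ [a [b [D [mD ->]]]] /=.
have [i [f [mf Vf Vi]]] := hV a b.
have [ii0|ii0] := eqVneq i i0.
  have [r Vr] := Vi ii0.
  have [Dr|Dr] := pselect (D r).
    rewrite (_ : _ @^-1` _ = setT).
      by have := sigma_algebraC (@sigma_algebra0 _ setT rest_events); rewrite setC0.
    by apply/seteqP; split => // w _ /=; rewrite Vr.
  rewrite (_ : _ @^-1` _ = set0); first exact: sigma_algebra0.
  by apply/seteqP; split => // w /=; rewrite Vr.
apply: sub_gen_smallest; exists (fun j => if j == i then f @^-1` D else setT); split.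
  by move=> j; case: ifP => // _; rewrite -[X in measurable X]setTI; exact: mf.
apply/seteqP; split => w /=.
  by rewrite Vf => Dw j _; case: eqP => // ->.
by move=> /(_ _ ii0); rewrite eqxx Vf.
Qed.

End rest.
End independence_theory.

(** * Measurability of matrix operations *)

Section measurable_mx.
Context {R : realType}.

Lemma measurable_mx_entry m n (i : 'I_m) (j : 'I_n) :
  measurable_fun setT (fun M : 'M[R]_(m, n) => M i j).
Proof.
move=> _ B mB; rewrite setTI; apply: sub_gen_smallest.
by exists i, j, B.
Qed.

Context {d : measure_display} {T : measurableType d}.

Lemma measurable_mxP m n (f : T -> 'M[R]_(m, n)) :
  (forall i j, measurable_fun setT (fun x => f x i j)) <-> measurable_fun setT f.
Proof.
split=> [mf|mf i j]; last exact: measurableT_comp (measurable_mx_entry i j) mf.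
apply: (@measurability _ _ _ _ _ _ (@mx_cylinders R m n)) => //.
move=> _ [_ [i [j [B [mB ->]]]] <-]; rewrite setTI.
by have := mf i j measurableT _ mB; rewrite setTI.
Qed.

Lemma measurable_fun_inv (f : T -> R) :
  measurable_fun setT f -> measurable_fun setT (fun x => (f x)^-1).
Proof.
move=> mf; apply: (@measurableT_comp _ _ _ _ _ _ (@GRing.inv R)) => //.
have -> : (setT : set R) = [set 0] `|` ~` [set 0] by rewrite setUv.
apply/measurable_funU => //; first exact: measurableC.
split; first exact: measurable_fun_set1.
apply: open_continuous_measurable_fun.
  by rewrite openC; exact: closed_eq.
by move=> x; rewrite inE/= => /eqP x0; exact: inv_continuous.
Qed.

Lemma measurable_mulmx m n p (f : T -> 'M[R]_(m, n)) (g : T -> 'M[R]_(n, p)) :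
  measurable_fun setT f -> measurable_fun setT g ->
  measurable_fun setT (fun x => f x *m g x).
Proof.
move=> /measurable_mxP mf /measurable_mxP mg; apply/measurable_mxP => i j.
under eq_fun do rewrite mxE.
by apply: measurable_sum => k; apply: measurable_funM.
Qed.

Lemma measurable_mxD m n (f g : T -> 'M[R]_(m, n)) :
  measurable_fun setT f -> measurable_fun setT g ->
  measurable_fun setT (fun x => f x + g x).
Proof.
move=> /measurable_mxP mf /measurable_mxP mg; apply/measurable_mxP => i j.
by under eq_fun do rewrite mxE; apply: measurable_funD.
Qed.

Lemma measurable_mxN m n (f : T -> 'M[R]_(m, n)) :
  measurable_fun setT f -> measurable_fun setT (fun x => - f x).
Proof.
move=> /measurable_mxP mf; apply/measurable_mxP => i j.
by under eq_fun do rewrite mxE; apply: measurable_funN.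
Qed.

Lemma measurable_mxZ m n (c : T -> R) (f : T -> 'M[R]_(m, n)) :
  measurable_fun setT c -> measurable_fun setT f ->
  measurable_fun setT (fun x => c x *: f x).
Proof.
move=> mc /measurable_mxP mf; apply/measurable_mxP => i j.
by under eq_fun do rewrite mxE; apply: measurable_funM.
Qed.

Lemma measurable_trmx m n (f : T -> 'M[R]_(m, n)) :
  measurable_fun setT f -> measurable_fun setT (fun x => (f x)^T).
Proof.
move=> /measurable_mxP mf; apply/measurable_mxP => i j.
by under eq_fun do rewrite mxE; apply: mf.
Qed.

Lemma measurable_det n (f : T -> 'M[R]_n) :
  measurable_fun setT f -> measurable_fun setT (fun x => \det (f x)).
Proof.
move=> /measurable_mxP mf; rewrite /determinant.
apply: measurable_sum => s; apply: measurable_funM => //.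
by apply: measurable_prod => i _; exact: mf.
Qed.

Lemma measurable_invmx n (f : T -> 'M[R]_n) : (forall x, f x \in unitmx) ->
  measurable_fun setT f -> measurable_fun setT (fun x => invmx (f x)).
Proof.
move=> uf mf; rewrite /invmx; under eq_fun do rewrite uf.
apply: measurable_mxZ; first exact/measurable_fun_inv/measurable_det.
apply/measurable_mxP => i j; under eq_fun do rewrite mxE.
rewrite /cofactor; apply: measurable_funM => //; apply: measurable_det.
apply/measurable_mxP => k l; under eq_fun do rewrite !mxE.
by move/measurable_mxP: mf; apply.
Qed.

End measurable_mx.

(** * Test functions *)

Section test_functions.
Context {R : realType} {a b : nat}.
Local Notation D := 'M[R]_(a, b).

(** A class in which integration by parts holds in every direction: boundedness
    makes all the integrals finite, and continuity along lines is what the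
    fundamental theorem of calculus needs, one coordinate at a time.  The class is
    closed under sums and products, hence under matrix products. *)
Definition testfun (f : D -> R) : Prop :=
  [/\ measurable_fun setT f, exists C, forall y, `|f y| <= C &
      forall y h, continuous (fun t : R => f (y + t *: h))].

Lemma testfun_cst r : testfun (fun=> r).
Proof.
split; first exact: measurable_cst.
  by exists `|r|.
by move=> y h t; exact: cvg_cst.
Qed.

Lemma testfunD f g : testfun f -> testfun g -> testfun (fun y => f y + g y).
Proof.
move=> [mf [C fC] cf] [mg [C' gC'] cg]; split.
- exact: measurable_funD.
- by exists (C + C') => y; rewrite (le_trans (ler_normD _ _))// lerD.
- by move=> y h t; apply: cvgD; [exact: cf|exact: cg].
Qed.

Lemma testfunM f g : testfun f -> testfun g -> testfun (fun y => f y * g y).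
Proof.
move=> [mf [C fC] cf] [mg [C' gC'] cg]; split.
- exact: measurable_funM.
- by exists (C * C') => y; rewrite normrM ler_pM.
- by move=> y h t; apply: cvgM; [exact: cf|exact: cg].
Qed.

Lemma testfunN f : testfun f -> testfun (fun y => - f y).
Proof.
move=> nf; rewrite (_ : (fun _ => _) = (fun y => -1 * f y)).
  exact: testfunM (testfun_cst _) nf.
by apply/funext => y; rewrite mulN1r.
Qed.

Lemma testfun_sum (I : Type) (r : seq I) (P : pred I) (f : I -> D -> R) :
  (forall i, testfun (f i)) -> testfun (fun y => \sum_(i <- r | P i) f i y).
Proof.
move=> nf; elim: r => [|i r IH].
  by under eq_fun do rewrite big_nil; exact: testfun_cst.
under eq_fun do rewrite big_cons; case: (P i) => //.
exact: testfunD.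
Qed.

Definition testmx m n (F : D -> 'M[R]_(m, n)) : Prop :=
  forall i j, testfun (fun y => F y i j).

Lemma testmx_cst m n (M : 'M[R]_(m, n)) : testmx (fun=> M).
Proof. by move=> i j; exact: testfun_cst. Qed.

Lemma testmxD m n (F G : D -> 'M[R]_(m, n)) : testmx F -> testmx G ->
  testmx (fun y => F y + G y).
Proof. by move=> nF nG i j; under eq_fun do rewrite mxE; exact: testfunD. Qed.

Lemma testmxN m n (F : D -> 'M[R]_(m, n)) : testmx F -> testmx (fun y => - F y).
Proof. by move=> nF i j; under eq_fun do rewrite mxE; exact: testfunN. Qed.

Lemma testmxB m n (F G : D -> 'M[R]_(m, n)) : testmx F -> testmx G ->
  testmx (fun y => F y - G y).
Proof. by move=> nF nG; apply: testmxD => //; exact: testmxN. Qed.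

Lemma testmxZ m n (c : D -> R) (F : D -> 'M[R]_(m, n)) : testfun c -> testmx F ->
  testmx (fun y => c y *: F y).
Proof. by move=> nc nF i j; under eq_fun do rewrite mxE; exact: testfunM. Qed.

Lemma testmx_tr m n (F : D -> 'M[R]_(m, n)) : testmx F -> testmx (fun y => (F y)^T).
Proof. by move=> nF i j; under eq_fun do rewrite mxE; exact: nF. Qed.

Lemma testmxM m n p (F : D -> 'M[R]_(m, n)) (G : D -> 'M[R]_(n, p)) :
  testmx F -> testmx G -> testmx (fun y => F y *m G y).
Proof.
move=> nF nG i j; under eq_fun do rewrite mxE.
by apply: testfun_sum => k; exact: testfunM.
Qed.

Lemma testfun_mxtrace n (F : D -> 'M[R]_n) : testmx F -> testfun (fun y => \tr (F y)).
Proof. by move=> nF; rewrite /mxtrace; apply: testfun_sum => i; exact: nF. Qed.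

End test_functions.

(** * Derivatives of matrix-valued curves *)

Lemma cvg_sumr {R : realType} {T : Type} (F : set_system T) {FF : Filter F}
    (I : Type) (r : seq I) (P : pred I) (f : I -> T -> R) (l : I -> R) :
  (forall i, P i -> f i x @[x --> F] --> l i) ->
  \sum_(i <- r | P i) f i x @[x --> F] --> \sum_(i <- r | P i) l i.
Proof.
move=> fl; elim: r => [|i r IH].
  by rewrite big_nil; under eq_fun do rewrite big_nil; exact: cvg_cst.
rewrite big_cons; under eq_fun do rewrite big_cons.
by have := fl i; case: (P i) => // /(_ isT) fi; exact: cvgD.
Qed.

Section curves.
Context {R : realType}.

(** Differentiability at 0 in the form of Caratheodory, for which the product and
    inverse rules are algebraic identities between difference quotients.  The point
    0 suffices for curves [t |-> F (y + t *: h)], since [y] is arbitrary. *)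
Definition deriv0 (f : R -> R) (df : R) : Prop := exists g : R -> R,
  [/\ forall t, f t = f 0 + t * g t, {for 0, continuous g} & g 0 = df].

Lemma deriv0_is_derive f df : deriv0 f df -> is_derive (0 : R) 1 f df.
Proof.
move=> [g [fg cg g0]]; apply/is_derive1_caratheodory; exists g; split => //.
by move=> t; rewrite fg subr0 addrC addKr mulrC.
Qed.

Lemma deriv0_continuous f df : deriv0 f df -> {for 0, continuous f}.
Proof. by move=> /deriv0_is_derive; exact: is_derive_continuous. Qed.

Lemma deriv0_cst r : deriv0 (fun=> r) 0.
Proof.
exists (fun=> 0); split => // [t|]; first by rewrite mulr0 addr0.
exact: cvg_cst.
Qed.

Lemma deriv0D f g df dg : deriv0 f df -> deriv0 g dg ->
  deriv0 (fun t => f t + g t) (df + dg).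
Proof.
move=> [f' [ff cf f0]] [g' [gg cg g0]]; exists (fun t => f' t + g' t); split.
- by move=> t; rewrite ff gg; ring.
- by apply: cvgD; [exact: cf|exact: cg].
- by rewrite f0 g0.
Qed.

Lemma deriv0M f g df dg : deriv0 f df -> deriv0 g dg ->
  deriv0 (fun t => f t * g t) (df * g 0 + f 0 * dg).
Proof.
move=> sf [g' [gg cg g0]]; have cf0 := deriv0_continuous sf.
move: sf => [f' [ff cf f0]].
exists (fun t => f' t * g 0 + f t * g' t); split.
- by move=> t; rewrite gg ff; ring.
- apply: cvgD; first by apply: cvgM; [exact: cf|exact: cvg_cst].
  by apply: cvgM; [exact: cf0|exact: cg].
- by rewrite f0 g0.
Qed.

Lemma deriv0_sum (I : Type) (r : seq I) (P : pred I) (f : I -> R -> R) df :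
  (forall i, deriv0 (f i) (df i)) ->
  deriv0 (fun t => \sum_(i <- r | P i) f i t) (\sum_(i <- r | P i) df i).
Proof.
move=> h; elim: r => [|i r IH].
  rewrite big_nil; under eq_fun do rewrite big_nil; exact: deriv0_cst.
rewrite big_cons; under eq_fun do rewrite big_cons.
by case: (P i) => //; exact: deriv0D.
Qed.

Lemma deriv0V f df : (forall t, f t != 0) -> deriv0 f df ->
  deriv0 (fun t => (f t)^-1) (- (f 0)^-2 * df).
Proof.
move=> fn0 sf; have cf0 := deriv0_continuous sf.
move: sf => [f' [ff cf f0]].
exists (fun t => - ((f t)^-1 * (f 0)^-1) * f' t); split.
- move=> t; have := fn0 t; have := fn0 0; have := ff t.
  move: (f t) (f 0) (f' t) => x y z ->  h1 h2.
  by field; rewrite h1 h2.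
- apply: cvgM; last exact: cf.
  apply: cvgN; apply: cvgM; last exact: cvg_cst.
  by apply: cvgV => //; exact: cf0.
- by rewrite f0; congr (_ * _); rewrite expr2 invfM.
Qed.

Definition mxderiv0 m n (F : R -> 'M[R]_(m, n)) (dF : 'M[R]_(m, n)) : Prop :=
  forall i j, deriv0 (fun t => F t i j) (dF i j).

Lemma mxderiv0_cst m n (M : 'M[R]_(m, n)) : mxderiv0 (fun=> M) 0.
Proof. by move=> i j; rewrite mxE; exact: deriv0_cst. Qed.

Lemma mxderiv0_line m n (Y h : 'M[R]_(m, n)) : mxderiv0 (fun t => Y + t *: h) h.
Proof.
move=> i j; exists (fun=> h i j); split => // [t|]; last exact: cvg_cst.
by rewrite !mxE mul0r addr0.
Qed.

Lemma mxderiv0D m n (F G : R -> 'M[R]_(m, n)) dF dG : mxderiv0 F dF -> mxderiv0 G dG ->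
  mxderiv0 (fun t => F t + G t) (dF + dG).
Proof.
move=> hF hG i j; rewrite mxE; under eq_fun do rewrite mxE; exact: deriv0D.
Qed.

Lemma mxderiv0Z m n c dc (F : R -> 'M[R]_(m, n)) dF : deriv0 c dc -> mxderiv0 F dF ->
  mxderiv0 (fun t => c t *: F t) (dc *: F 0 + c 0 *: dF).
Proof.
by move=> hc hF i j; rewrite !mxE; under eq_fun do rewrite mxE; exact: deriv0M.
Qed.

Lemma mxderiv0_tr m n (F : R -> 'M[R]_(m, n)) dF : mxderiv0 F dF ->
  mxderiv0 (fun t => (F t)^T) dF^T.
Proof. by move=> hF i j; rewrite !mxE; under eq_fun do rewrite mxE. Qed.

Lemma mxderiv0M m n p (F : R -> 'M[R]_(m, n)) (G : R -> 'M[R]_(n, p)) dF dG :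
  mxderiv0 F dF -> mxderiv0 G dG ->
  mxderiv0 (fun t => F t *m G t) (dF *m G 0 + F 0 *m dG).
Proof.
move=> hF hG i j; rewrite !mxE -big_split/=; under eq_fun do rewrite mxE.
by apply: deriv0_sum => k; exact: deriv0M.
Qed.

Lemma mxderiv0_eq m n (F : R -> 'M[R]_(m, n)) dF dF' : mxderiv0 F dF -> dF = dF' ->
  mxderiv0 F dF'.
Proof. by move=> ? <-. Qed.

(** The difference of the inverses at [t] and at 0 is
    [- K(t)^-1 (K(t) - K(0)) K(0)^-1].  As the inverses are bounded, this first shows
    that they are continuous at 0, and then gives the limit of the difference
    quotients. *)
Lemma mxderiv0_invmx n (K : R -> 'M[R]_n) dK (C : R) : (forall t, K t \in unitmx) ->
  (forall t i j, `|invmx (K t) i j| <= C) -> mxderiv0 K dK ->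
  mxderiv0 (fun t => invmx (K t)) (- (invmx (K 0) *m dK *m invmx (K 0))).
Proof.
move=> uK bK dK0.
have /choice[G hG] : forall ij : 'I_n * 'I_n, exists g : R -> R,
    [/\ forall t, K t ij.1 ij.2 = K 0 ij.1 ij.2 + t * g t,
        {for 0, continuous g} & g 0 = dK ij.1 ij.2].
  by move=> ij; exact: dK0.
pose H t := \matrix_(i, j) G (i, j) t.
have KH t : K t = K 0 + t *: H t.
  by apply/matrixP => i j; have [-> _ _] := hG (i, j); rewrite !mxE.
have H0 : H 0 = dK.
  by apply/matrixP => i j; have [_ _] := hG (i, j); rewrite mxE.
have eq1 t : invmx (K t) = invmx (K 0) - t *: (invmx (K t) *m H t *m invmx (K 0)).
  rewrite scalemxAl scalemxAr -[_ *: H t](addKr (K 0)) -KH.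
  rewrite mulmxDr mulmxDl mulmxN mulNmx.
  by rewrite mulVmx// mul1mx -mulmxA mulmxV// mulmx1 opprD opprK addrC subrK.
have cH i j : {for 0, continuous (fun t => H t i j)}.
  by have [_ c _] := hG (i, j); rewrite (_ : (fun _ => _) = G (i, j))//;
    apply/funext => t; rewrite mxE.
have cHK i j : {for 0, continuous (fun t => (H t *m invmx (K 0)) i j)}.
  have -> : (fun t => (H t *m invmx (K 0)) i j) =
    (fun t => \sum_k H t i k * invmx (K 0) k j).
    by apply/funext => t; rewrite mxE.
  by apply: cvg_sumr => k _; apply: cvgM; [exact: cH|exact: cvg_cst].
have tK i j : t * invmx (K t) i j @[t --> 0] --> (0 : R).
  apply: (@squeeze_cvgr _ _ _ _ (fun t => - (C * `|t|)) (fun t => C * `|t|)).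
  - by apply: nearW => t; rewrite -ler_norml normrM mulrC ler_wpM2r.
  - rewrite -[X in _ --> X]oppr0 -[X in _ --> - X](mulr0 C) -[X in _ * X](@normr0 _ R).
    by apply: cvgN; apply: cvgMr; apply: cvg_norm; exact: cvg_id.
  - rewrite -[X in _ --> X](mulr0 C) -[X in _ * X](@normr0 _ R).
    by apply: cvgMr; apply: cvg_norm; exact: cvg_id.
have cK i j : {for 0, continuous (fun t => invmx (K t) i j)}.
  have E t : invmx (K t) i j = invmx (K 0) i j -
      \sum_k (t * invmx (K t) i k) * (H t *m invmx (K 0)) k j.
    rewrite [in LHS]eq1 mxE [in X in _ + X]mxE [in X in _ + X]mxE.
    congr (_ - _); rewrite -mulmxA mxE mulr_sumr; apply: eq_bigr => k _.
    by rewrite mulrA.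
  suff : (invmx (K 0) i j - \sum_k (t * invmx (K t) i k) *
      (H t *m invmx (K 0)) k j) @[t --> 0] --> invmx (K 0) i j.
    by under eq_fun do rewrite -E.
  rewrite -[X in _ --> X]subr0; apply: cvgB; first exact: cvg_cst.
  rewrite -[X in _ --> X](_ : \sum_(k < n) (0 : R) = 0); last by rewrite big1.
  apply: cvg_sumr => k _; rewrite -[X in _ --> X](mul0r ((H 0 *m invmx (K 0)) k j)).
  by apply: cvgM; [exact: tK|exact: cHK].
move=> i j; exists (fun t => - \sum_k invmx (K t) i k * (H t *m invmx (K 0)) k j).
split.
- move=> t; rewrite [in LHS]eq1 mxE [in X in _ + X]mxE [in X in _ + X]mxE.
  by rewrite mulrN -mulmxA mxE.
- apply: cvgN; apply: cvg_sumr => k _.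
  by apply: cvgM; [exact: cK|exact: cHK].
- by rewrite -mulmxA H0 !mxE.
Qed.

End curves.

(** * The regularised inverse of a Gram matrix *)

Section dot.
Context {R : realType}.

Definition dot m (u v : 'cV[R]_m) : R := (u^T *m v) 0 0.

Lemma dotE m (u v : 'cV[R]_m) : dot u v = \sum_i u i 0 * v i 0.
Proof. by rewrite /dot mxE; apply: eq_bigr => i _; rewrite mxE. Qed.

Lemma dotC m (u v : 'cV[R]_m) : dot u v = dot v u.
Proof. by rewrite !dotE; apply: eq_bigr => i _; rewrite mulrC. Qed.

Lemma dotDr m (u v w : 'cV[R]_m) : dot u (v + w) = dot u v + dot u w.
Proof. by rewrite /dot mulmxDr mxE. Qed.

Lemma dotZr m c (u v : 'cV[R]_m) : dot u (c *: v) = c * dot u v.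
Proof. by rewrite /dot -scalemxAr mxE. Qed.

Lemma dotNr m (u v : 'cV[R]_m) : dot u (- v) = - dot u v.
Proof. by rewrite /dot mulmxN mxE. Qed.

Lemma dotBr m (u v w : 'cV[R]_m) : dot u (v - w) = dot u v - dot u w.
Proof. by rewrite dotDr dotNr. Qed.

Lemma dotDl m (u v w : 'cV[R]_m) : dot (v + w) u = dot v u + dot w u.
Proof. by rewrite dotC dotDr !(dotC u). Qed.

Lemma dotZl m c (u v : 'cV[R]_m) : dot (c *: v) u = c * dot v u.
Proof. by rewrite dotC dotZr (dotC u). Qed.

Lemma dotNl m (u v : 'cV[R]_m) : dot (- v) u = - dot v u.
Proof. by rewrite dotC dotNr (dotC u). Qed.

Lemma dotBl m (u v w : 'cV[R]_m) : dot (v - w) u = dot v u - dot w u.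
Proof. by rewrite dotDl dotNl. Qed.

Lemma dot_mull m n (A : 'M[R]_(m, n)) u v : dot (A *m u) v = dot u (A^T *m v).
Proof. by rewrite /dot trmx_mul mulmxA. Qed.

Lemma mxtrace_dot m (u v : 'cV[R]_m) : \tr (u *m v^T) = dot v u.
Proof. by rewrite mxtrace_mulC /dot trace_mx11. Qed.

Lemma dot_ge0 m (u : 'cV[R]_m) : 0 <= dot u u.
Proof. by rewrite dotE sumr_ge0// => i _; rewrite -expr2 sqr_ge0. Qed.

Lemma sqr_le_dot m (u : 'cV[R]_m) i : u i 0 ^+ 2 <= dot u u.
Proof.
rewrite dotE (bigD1 i)//= -expr2 lerDl sumr_ge0// => j _.
by rewrite -expr2 sqr_ge0.
Qed.

Lemma dot_eq0 m (u : 'cV[R]_m) : dot u u = 0 -> u = 0.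
Proof.
move=> u0; apply/matrixP => i j; rewrite (ord1 j) mxE.
have := sqr_le_dot u i; rewrite u0 => h; apply/eqP.
by rewrite -sqrf_eq0 eq_le h sqr_ge0.
Qed.

Lemma dot_delta m (i : 'I_m) : dot (delta_mx i 0) (delta_mx i 0) = 1.
Proof.
rewrite dotE (bigD1 i)//= !mxE !eqxx mulr1 big1 ?addr0// => j ji.
by rewrite !mxE (negbTE ji) mul0r.
Qed.

Lemma mul_delta m n (A : 'M[R]_(m, n)) i j :
  (A *m delta_mx j (0 : 'I_1)) i 0 = A i j.
Proof. by rewrite -colE mxE. Qed.

Lemma dot_deltal m (i : 'I_m) (v : 'cV[R]_m) : dot (delta_mx i 0) v = v i 0.
Proof.
rewrite dotE (bigD1 i)//= !mxE !eqxx mul1r big1 ?addr0// => j ji.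
by rewrite !mxE (negbTE ji) mul0r.
Qed.

Lemma entry_sqr_le m n (A : 'M[R]_(m, n)) (C : R) :
  (forall u, dot (A *m u) (A *m u) <= C * dot u u) ->
  forall i j, A i j ^+ 2 <= C.
Proof.
move=> h i j; rewrite -(mul_delta A) (le_trans (sqr_le_dot _ _))//.
by rewrite (le_trans (h _))// dot_delta mulr1.
Qed.

Lemma norm_le_sqr (z B : R) : z ^+ 2 <= B -> `|z| <= 1 + B.
Proof.
rewrite -real_normK ?num_real// => h.
have := sqr_ge0 (`|z| - 1); have := normr_ge0 z; nra.
Qed.

Lemma norm_le1_sqr (z : R) : z ^+ 2 <= 1 -> `|z| <= 1.
Proof. by rewrite -real_normK ?num_real// expr_le1. Qed.

End dot.

Section tikhonov.
Context {R : realType} {n p : nat} (de : R).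
Hypothesis de0 : 0 < de.
Implicit Types (Y : 'M[R]_(n, p)).

Definition tikmx Y : 'M[R]_n := Y *m Y^T + de%:M.

(** Unlike the inverse of [Y *m Y^T], this Tikhonov-regularised inverse is defined,
    smooth and bounded on the whole space of matrices. *)
Definition tik Y : 'M[R]_n := invmx (tikmx Y).

Lemma dot_tikmx Y u v : dot u (tikmx Y *m v) = dot (Y^T *m u) (Y^T *m v) + de * dot u v.
Proof.
by rewrite /tikmx mulmxDl dotDr mul_scalar_mx dotZr dot_mull trmxK mulmxA.
Qed.

Lemma tikmx_unit Y : tikmx Y \in unitmx.
Proof.
rewrite -unitmx_tr -row_free_unit; apply/inj_row_free => v vK.
have K0 : tikmx Y *m v^T = 0 by rewrite -[tikmx Y]trmxK -trmx_mul vK trmx0.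
have : dot v^T (tikmx Y *m v^T) = 0 by rewrite K0 /dot mulmx0 mxE.
rewrite dot_tikmx => h.
have /dot_eq0 : dot v^T v^T = 0.
  apply/eqP; move/eqP: h; rewrite paddr_eq0 ?dot_ge0//; last first.
    by rewrite mulr_ge0 ?dot_ge0 ?ltW.
  by move=> /andP[_]; rewrite mulf_eq0 gt_eqF.
by move/(congr1 trmx); rewrite trmxK trmx0.
Qed.

Lemma tikmx_sym Y : (tikmx Y)^T = tikmx Y.
Proof. by rewrite /tikmx linearD/= trmx_mul trmxK tr_scalar_mx. Qed.

Lemma tik_sym Y : (tik Y)^T = tik Y.
Proof. by rewrite /tik trmx_inv tikmx_sym. Qed.

Lemma tikmxK Y m (A : 'M[R]_(n, m)) : tikmx Y *m (tik Y *m A) = A.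
Proof. by rewrite mulKVmx// tikmx_unit. Qed.

Lemma tik_gram Y : tik Y *m (Y *m Y^T) = 1%:M - de *: tik Y.
Proof.
have -> : Y *m Y^T = tikmx Y - de%:M by rewrite addrK.
by rewrite mulmxBr mulVmx ?tikmx_unit// mul_mx_scalar.
Qed.

Lemma gram_tik Y : Y *m Y^T *m tik Y = 1%:M - de *: tik Y.
Proof.
have -> : Y *m Y^T = tikmx Y - de%:M by rewrite addrK.
by rewrite mulmxBl mulmxV ?tikmx_unit// mul_scalar_mx.
Qed.

Lemma dot_tik Y w : dot w (tik Y *m w) =
  dot (Y^T *m (tik Y *m w)) (Y^T *m (tik Y *m w)) + de * dot (tik Y *m w) (tik Y *m w).
Proof. by rewrite -{1}(tikmxK Y w) dotC dot_tikmx. Qed.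

Lemma tik_ge0 Y w : 0 <= dot w (tik Y *m w).
Proof. by rewrite dot_tik addr_ge0 ?mulr_ge0 ?dot_ge0// ltW. Qed.

(** Expand [|w - de r|^2 >= 0] for [r := tik Y *m w]. *)
Lemma tik_contract Y w : de ^+ 2 * dot (tik Y *m w) (tik Y *m w) <= dot w w.
Proof.
have h1 := dot_tik Y w; set r := tik Y *m w in h1 *.
have h2 := dot_ge0 (w - de *: r); have h3 := dot_ge0 (Y^T *m r).
rewrite dotBl !dotBr !dotZl !dotZr (dotC r w) h1 in h2.
have := mulr_ge0 (ltW de0) h3.
by move: (dot w w) (dot r r) (dot (Y^T *m r) _) h2 => a b c ? ?; nra.
Qed.

Lemma scaled_tik_entry Y i j : `|(de *: tik Y) i j| <= 1.
Proof.
apply: norm_le1_sqr; move: i j; apply: entry_sqr_le => u.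
by rewrite -scalemxAl dotZl dotZr mulrA -expr2 mul1r tik_contract.
Qed.

Lemma tik_entry Y i j : `|tik Y i j| <= de^-1.
Proof.
have := scaled_tik_entry Y i j; rewrite mxE normrM gtr0_norm// => h.
by rewrite -ler_pdivlMl// in h; rewrite mulr1 in h.
Qed.

Lemma tik_diag_ge0 Y i : 0 <= tik Y i i.
Proof.
by have := tik_ge0 Y (delta_mx i 0); rewrite dot_deltal mul_delta.
Qed.

Section vectors.
Variables (Y : 'M[R]_(n, p)) (x : 'cV[R]_p).
Let W := tik Y *m Y *m x.
Let v := Y^T *m W.

(** [W] and [v] are the coefficients and the fitted value of the ridge regression
    of [x] on the rows of [Y]; these are its normal equations. *)
Lemma mulmx_residual : Y *m (x - v) = de *: W.
Proof.
rewrite mulmxBr /v mulmxA /W -!mulmxA (mulmxA Y) (mulmxA (Y *m Y^T)) gram_tik.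
by rewrite mulmxBl mul1mx opprB addrC subrK -scalemxAl.
Qed.

Lemma dot_residual : dot v (x - v) = de * dot W W.
Proof. by rewrite /v dot_mull trmxK -/v mulmx_residual dotZr. Qed.

(** Expand [|x - v|^2 >= 0]. *)
Lemma dot_vvec_le : dot v v + 2 * de * dot W W <= dot x x.
Proof.
have := dot_residual; have := dot_ge0 (x - v).
rewrite dotBl !dotBr (dotC x v).
move: (dot v x) (dot v v) (dot x x) (dot W W) => a b c e; nra.
Qed.

Lemma tik_Y_v : tik Y *m Y *m v = W - de *: (tik Y *m W).
Proof. by rewrite /v mulmxA -(mulmxA (tik Y)) tik_gram mulmxBl mul1mx -scalemxAl. Qed.

End vectors.

Lemma smoother_entry Y i j : `|(Y^T *m tik Y *m Y) i j| <= 1.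
Proof.
apply: norm_le1_sqr; move: i j; apply: entry_sqr_le => u.
have := dot_vvec_le Y u; rewrite mul1r -!mulmxA; apply: le_trans.
by rewrite lerDl !mulr_ge0 ?dot_ge0// ltW.
Qed.

Lemma tikY_entry Y i j : `|(tik Y *m Y) i j| <= 1 + de^-1.
Proof.
apply: norm_le_sqr; move: i j; apply: entry_sqr_le => u.
have := dot_vvec_le Y u; have := dot_ge0 (Y^T *m (tik Y *m Y *m u)).
have := mulr_ge0 (ltW de0) (dot_ge0 (tik Y *m Y *m u)); rewrite ler_pdivlMl//.
by move: (dot _ _) (dot _ _) (dot _ _) => a b c; lra.
Qed.

Lemma mxtrace_smoother Y : \tr (Y^T *m tik Y *m Y) = n%:R - de * \tr (tik Y).
Proof.
rewrite mxtrace_mulC mulmxA gram_tik linearB/= linearZ/= mxtrace1.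
by [].
Qed.

Lemma tr_tik_ge0 Y : 0 <= \tr (tik Y).
Proof. by rewrite sumr_ge0// => i _; exact: tik_diag_ge0. Qed.

Definition tikabs Y : R := \sum_i \sum_j `|tik Y i j|.

Lemma tikabs_ge0 Y : 0 <= tikabs Y.
Proof. by rewrite sumr_ge0// => i _; rewrite sumr_ge0. Qed.

Lemma tr_tik_le Y : \tr (tik Y) <= tikabs Y.
Proof.
apply: ler_sum => i _; rewrite (bigD1 i)//= (le_trans (ler_norm _))// lerDl.
exact: sumr_ge0.
Qed.

Lemma dot_tik_le Y w : dot w (tik Y *m w) <= tikabs Y * dot w w.
Proof.
rewrite dotE /tikabs mulr_suml; apply: ler_sum => i _.
rewrite mxE mulr_sumr mulr_suml; apply: ler_sum => j _.
rewrite mulrCA (le_trans (ler_norm _))// normrM ler_wpM2l// normrM.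
have h1 := sqr_le_dot w i; have h2 := sqr_le_dot w j.
rewrite -(@real_normK _ (w i 0)) ?num_real// in h1.
rewrite -(@real_normK _ (w j 0)) ?num_real// in h2.
have := sqr_ge0 (`|w i 0| - `|w j 0|); nra.
Qed.

(** Cauchy-Schwarz over the [n ^ 2] entries, from [2 y |M_ij| <= y^2 + M_ij^2] and the
    best choice of [y]. *)
Lemma tikabs_sqr Y : (0 < n)%N -> tikabs Y ^+ 2 <= n%:R ^+ 2 * \tr (tik Y *m tik Y).
Proof.
move=> n0'.
have -> : \tr (tik Y *m tik Y) = \sum_i \sum_j tik Y i j ^+ 2.
  apply: eq_bigr => i _; rewrite mxE; apply: eq_bigr => j _.
  by rewrite -{2}tik_sym mxE expr2.
rewrite /tikabs !pair_big/=; set S := \sum_p _ ^+ 2.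
have cs (m : R) : 2 * m * \sum_(q : 'I_n * 'I_n) `|tik Y q.1 q.2|
    <= n%:R ^+ 2 * m ^+ 2 + S.
  have -> : n%:R ^+ 2 * m ^+ 2 = \sum_(q : 'I_n * 'I_n) m ^+ 2.
    by rewrite sumr_const card_prod card_ord -[RHS]mulr_natl natrM [in LHS]expr2.
  rewrite mulr_sumr -big_split/=; apply: ler_sum => q _.
  rewrite -[X in _ + X]real_normK ?num_real//.
  have := sqr_ge0 (m - `|tik Y q.1 q.2|); nra.
set A := \sum_q _ in cs *.
have A0 : 0 <= A by exact: sumr_ge0.
have S0 : 0 <= S by apply: sumr_ge0 => q _; exact: sqr_ge0.
have n1 : 0 < n%:R :> R by rewrite ltr0n.
have n0 := lt0r_neq0 n1.
have N0 : 0 < n%:R ^+ 2 :> R by rewrite exprn_gt0.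
have := cs (A / n%:R ^+ 2); move: (n%:R ^+ 2) N0 => N N0.
have -> : A = N * (A / N) by field; exact: lt0r_neq0.
rewrite [N * _ / N]mulrC mulKf ?lt0r_neq0//.
move: (A / N) => y h; have : N * y ^+ 2 <= S by lra.
by rewrite -(ler_pM2l N0); lra.
Qed.

End tikhonov.

(** * Integration by parts for normal vectors and normal rows *)

Section test_functions_bis.
Context {R : realType}.

Lemma testfun_comp a b a' b' (f : 'M[R]_(a, b) -> R)
    (phi : 'M[R]_(a', b') -> 'M[R]_(a, b)) :
  testfun f -> measurable_fun setT phi ->
  (forall y h, exists h', forall t, phi (y + t *: h) = phi y + t *: h') ->
  testfun (f \o phi).
Proof.
move=> [mf [C fC] cf] mphi lphi; split.
- exact: measurableT_comp.
- by exists C => y; exact: fC.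
- move=> y h; have [h' h'E] := lphi y h.
  rewrite (_ : (fun _ => _) = (fun t => f (phi y + t *: h'))) //.
  by apply/funext => t; rewrite /= h'E.
Qed.

Lemma is_derive_line a b (f f' : 'M[R]_(a, b) -> R) h :
  (forall z, deriv0 (fun t => f (z + t *: h)) (f' z)) ->
  forall y (t : R), is_derive t 1 (fun s => f (y + s *: h)) (f' (y + t *: h)).
Proof.
move=> df y t; have [g [fg cg g0]] := df (y + t *: h).
apply/is_derive1_caratheodory; exists (fun s => g (s - t)); split.
- move=> s; have := fg (s - t); rewrite scale0r addr0 -addrA -scalerDl.
  by rewrite (addrC t) subrK => ->; rewrite addrC addKr mulrC.
- suff : g (s - t) @[s --> t] --> g (t - t) by [].
  rewrite subrr.
  have st : s - t @[s --> t] --> (0 : R).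
    by rewrite -[X in _ --> X](subrr t); apply: cvgB; [exact: cvg_id|exact: cvg_cst].
  exact: cvg_comp st cg.
- by rewrite subrr.
Qed.

Context {d : measure_display} {T : measurableType d} (P : probability T R).

Lemma bounded_integrable (f : T -> R) C : measurable_fun setT f ->
  (forall w, `|f w| <= C) -> P.-integrable setT (fun w => (f w)%:E).
Proof.
move=> mf fC; apply: measurable_bounded_integrable => //.
  by rewrite (le_lt_trans (probability_le1 _ _)) ?ltry.
exists C; split; rewrite ?num_real// => y Cy x _ /=.
by rewrite (le_trans (fC x))// ltW.
Qed.

Lemma testfun_integrable a b (f : 'M[R]_(a, b) -> R) (X : T -> 'M[R]_(a, b)) :
  testfun f -> measurable_fun setT X -> P.-integrable setT (fun w => (f (X w))%:E).
Proof.
move=> [mf [C fC] _] mX; apply: (@bounded_integrable _ C) => //.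
exact: measurableT_comp.
Qed.

Lemma integrable_bounded_mul (f g : T -> R) C :
  P.-integrable setT (fun w => (f w)%:E) -> measurable_fun setT g ->
  (forall w, `|g w| <= C) -> P.-integrable setT (fun w => (f w * g w)%:E).
Proof.
move=> intf mg gC.
apply: (@le_integrable _ _ _ P setT measurableT _ (fun w => C%:E * (f w)%:E)%E).
- apply/measurable_EFinP; apply: measurable_funM => //.
  by have /measurable_EFinP := measurable_int _ intf.
- move=> w _; rewrite -EFinM !abse_EFin lee_fin !normrM mulrC.
  by rewrite ler_wpM2r// (le_trans (gC w))// ler_norm.
- exact: integrableZl.
Qed.

End test_functions_bis.

Section stein_coord.
Context {R : realType} {d : measure_display} {T : measurableType d}.
Variables (P : probability T R) (p : nat) (Z : {RV P >-> 'cV[R]_p}).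
Hypothesis sZ : std_normal Z.

Let mZ (i : 'I_p) : measurable_fun setT (fun w => Z w i 0).
Proof. by move: i (0 : 'I_1); apply/measurable_mxP. Qed.

Lemma std_normal_coord_integrable (j : 'I_p) :
  P.-integrable setT (fun w => (Z w j 0)%:E).
Proof.
apply/integrableP; split; first exact/measurable_EFinP.
have := @integrable_normal_prob_id R => /integrableP[_].
apply: le_lt_trans.
pose Zj_mixin := @isMeasurableFun.Build _ _ T (measurableTypeR R) _ (mZ j).
pose Zj : {mfun T >-> measurableTypeR R} := HB.pack (fun w => Z w j 0) Zj_mixin.
have -> : (\int[normal_prob (0 : R) 1]_x `|x%:E| =
    \int[distribution P Zj]_x `|x%:E|)%E.
  apply: eq_measure_integral => A mA _.
  by have [h _] := sZ; rewrite /distribution /pushforward; apply/esym/h.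
rewrite ge0_integral_distribution//.
exact: measurableT_comp.
Qed.

(** The other coordinates are independent of the [j]-th one, so that they can be
    frozen while integrating by parts in the latter. *)
Lemma stein_coord (j : 'I_p) (f f' : 'cV[R]_p -> R) : testfun f -> testfun f' ->
  (forall z, deriv0 (fun t => f (z + t *: delta_mx j 0)) (f' z)) ->
  P.-integrable setT (fun w => (Z w j 0 * f (Z w))%:E) /\
  (\int[P]_w (Z w j 0 * f (Z w))%:E = \int[P]_w (f' (Z w))%:E)%E.
Proof.
move=> nf nf' df.
have iZf : P.-integrable setT (fun w => (Z w j 0 * f (Z w))%:E).
  have [mf [C fC] _] := nf; apply: (@integrable_bounded_mul _ _ _ _ _ _ C) => //.
    exact: std_normal_coord_integrable.
  exact: measurableT_comp.
split => //.
pose e : 'cV[R]_p := delta_mx j 0.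
pose V w : 'cV[R]_p := Z w - Z w j 0 *: e.
have mV : measurable_fun setT V.
  apply: measurable_mxD => //; apply: measurable_mxN; apply: measurable_mxZ => //.
pose V_mixin := isMeasurableFun.Build _ _ _ _ _ mV.
pose Vp : {mfun T >-> 'cV[R]_p} := HB.pack V V_mixin.
have [hZ indZ] := sZ.
have ind : independent P (fun w => Z w j 0) V.
  apply: (@independent_rest _ _ _ P _ _ _ (fun i w => Z w i 0) j) => // a b.
  rewrite (ord1 b); have [->|aj] := eqVneq a j.
    exists j, (fun=> 0); split; first exact: measurable_cst.
      by move=> w; rewrite !mxE !eqxx mulr1 subrr.
    by exists 0 => w; rewrite !mxE !eqxx mulr1 subrr.
  exists a, id; split; first exact: measurable_id.
    by move=> w; rewrite !mxE (negbTE aj) mulr0 subr0.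
  by move=> aj'; rewrite aj' eqxx in aj.
have UVE w : V w + Z w j 0 *: e = Z w by rewrite /V subrK.
have mphi : measurable_fun setT (fun z : R * 'cV[R]_p => z.2 + z.1 *: e).
  apply: measurable_mxD; first exact: measurable_snd.
  by apply: measurable_mxZ; [exact: measurable_fst|exact: measurable_cst].
have s (F : R * 'cV[R]_p -> R) : measurable_fun setT F ->
    P.-integrable setT (fun w => (F (Z w j 0, V w))%:E) ->
    (\int[P]_w (F (Z w j 0, V w))%:E =
     \int[distribution P Vp]_y \int[normal_prob (0 : R) 1]_t (F (t, y))%:E)%E.
  move=> mF iF.
  apply: (@integral_indep _ _ _ P _ _ (measurableTypeR R) _ (fun w => Z w j 0) V _ mV ind
    (normal_prob (0 : R) 1) (distribution P Vp) _ _ (fun z => (F z)%:E)) => //.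
  - exact: mZ.
  - by move=> A mA; exact: hZ.
  - exact/measurable_EFinP.
have [mf [C fC] _] := nf; have [mf' [C' fC'] cf'] := nf'.
pose F1 (z : R * 'cV[R]_p) := z.1 * f (z.2 + z.1 *: e).
pose F2 (z : R * 'cV[R]_p) := f' (z.2 + z.1 *: e).
have F1E w : F1 (Z w j 0, V w) = Z w j 0 * f (Z w) by rewrite /F1/= UVE.
have F2E w : F2 (Z w j 0, V w) = f' (Z w) by rewrite /F2/= UVE.
under eq_integral do rewrite -F1E.
under [RHS]eq_integral do rewrite -F2E.
rewrite (s F1) ?(s F2).
- apply: eq_integral => y _ /=.
  apply: (@stein_normal_prob _ _ (fun t => f' (y + t *: e)) (Num.max C C')).
  + exact: is_derive_line df y.
  + exact: cf'.
  + by move=> t; rewrite le_max fC.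
  + by move=> t; rewrite le_max fC' orbT.
- exact: measurableT_comp.
- by under eq_fun do rewrite F2E; exact: testfun_integrable.
- by apply: measurable_funM => //; exact: measurableT_comp.
- by under eq_fun do rewrite F1E.
Qed.

End stein_coord.

Lemma posdefmx_unit (R : realFieldType) p (M : 'M[R]_p) : posdefmx M -> M \in unitmx.
Proof.
move=> [Msym Mpos]; rewrite -row_free_unit; apply/inj_row_free => v vM.
apply/eqP; apply: contraT => v0.
have /Mpos : v^T != 0 by rewrite trmx_eq0.
by rewrite trmxK vM mul0mx mxE ltxx.
Qed.

Section stein_multinormal.
Context {R : realType} {d : measure_display} {T : measurableType d}.
Variables (P : probability T R) (p : nat).

Section affine.
Variables (theta : 'cV[R]_p) (A : 'M[R]_p).

Lemma testfun_affine (f : 'cV[R]_p -> R) : testfun f -> testfun (fun z => f (theta + A *m z)).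
Proof.
move=> nf; apply: (testfun_comp nf).
  apply: measurable_mxD; first exact: measurable_cst.
  by apply: measurable_mulmx; [exact: measurable_cst|exact: measurable_id].
by move=> y h; exists (A *m h) => t; rewrite mulmxDr -scalemxAr addrA.
Qed.

Lemma testmx_affine m n (F : 'cV[R]_p -> 'M[R]_(m, n)) : testmx F ->
  testmx (fun z => F (theta + A *m z)).
Proof. by move=> nF i j; apply: (testfun_affine (nF i j)). Qed.

End affine.

(** Any square root [A] of [Sigma] will do: in the standard normal coordinates the
    field becomes [A^-1 g], whose Jacobian [A^-1 L A] has the trace of [L]. *)
Lemma stein_multinormal (X : T -> 'cV[R]_p) (theta : 'cV[R]_p) (Sigma : 'M[R]_p)
    (g : 'cV[R]_p -> 'cV[R]_p) (L : 'cV[R]_p -> 'M[R]_p) :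
  posdefmx Sigma -> multinormal P X theta Sigma ->
  testmx g -> testmx L ->
  (forall y h, mxderiv0 (fun t => g (y + t *: h)) (L y *m h)) ->
  P.-integrable setT (fun w => (dot (X w - theta) (invmx Sigma *m g (X w)))%:E) /\
  (\int[P]_w (dot (X w - theta) (invmx Sigma *m g (X w)))%:E =
   \int[P]_w (\tr (L (X w)))%:E)%E.
Proof.
move=> /posdefmx_unit uS [A [Z [AS sZ XE]]] ng nL dg.
have uA : A \in unitmx by move: uS; rewrite -AS unitmx_mul => /andP[].
have uAt : A^T \in unitmx by rewrite unitmx_tr.
pose B := invmx A.
pose f j (z : 'cV[R]_p) : R := (B *m g (theta + A *m z)) j 0.
pose f' j (z : 'cV[R]_p) : R := (B *m L (theta + A *m z) *m A) j j.
have nf j : testfun (f j).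
  have : testmx (fun z => B *m g (theta + A *m z)).
    by apply: testmxM; [exact: testmx_cst|exact: testmx_affine].
  by apply.
have nf' j : testfun (f' j).
  have : testmx (fun z => B *m L (theta + A *m z) *m A).
    apply: testmxM; last exact: testmx_cst.
    by apply: testmxM; [exact: testmx_cst|exact: testmx_affine].
  by apply.
have df j z : deriv0 (fun t => f j (z + t *: delta_mx j 0)) (f' j z).
  have h := mxderiv0M (mxderiv0_cst B) (dg (theta + A *m z) (A *m delta_mx j 0)).
  have := h j 0; rewrite mul0mx add0r mulmxA mulmxA mul_delta.
  rewrite /f; under [X in deriv0 X _ -> _]eq_fun do
    rewrite scalemxAr -addrA -mulmxDr.
  by [].
have dotX w : dot (X w - theta) (invmx Sigma *m g (X w)) =
    \sum_j Z w j 0 * f j (Z w).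
  have AB : A^T *m invmx Sigma = B.
    apply: (can_inj (mulKmx uA)); rewrite mulmxA AS mulmxV//.
    by rewrite mulmxV.
  by rewrite XE addrC addKr dot_mull mulmxA AB dotE.
have trL w : \tr (L (X w)) = \sum_j f' j (Z w).
  by rewrite XE /f' -[RHS]/(\tr _) mxtrace_mulC mulmxA mulmxV// mul1mx.
have sc j := stein_coord sZ (nf j) (nf' j) (df j).
have mZ : measurable_fun setT Z by [].
have intf' j : P.-integrable setT (fun w => (f' j (Z w))%:E).
  exact: testfun_integrable.
have dotXE : (fun w => (dot (X w - theta) (invmx Sigma *m g (X w)))%:E) =
    (fun w => \sum_j (Z w j 0 * f j (Z w))%:E)%E.
  by apply/funext => w; rewrite dotX -sumEFin.
split; first by rewrite dotXE; apply: integrable_sum => // j _; have [] := sc j.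
rewrite dotXE; under [RHS]eq_integral do rewrite trL -sumEFin.
rewrite !integral_sum//; last by move=> j; have [] := sc j.
by apply: eq_bigr => j _; have [] := sc j.
Qed.

(** The integrability part of [stein_multinormal] for a constant field. *)
Lemma multinormal_coord_integrable (X : T -> 'cV[R]_p) theta Sigma k :
  posdefmx Sigma -> multinormal P X theta Sigma ->
  P.-integrable setT (fun w => (X w k 0 - theta k 0)%:E).
Proof.
move=> pS mX.
have [] := @stein_multinormal X theta Sigma (fun=> Sigma *m delta_mx k 0) (fun=> 0) pS mX.
- exact: testmx_cst.
- exact: testmx_cst.
- by move=> y h; rewrite mul0mx; exact: mxderiv0_cst.
move=> + _.
rewrite mulmxA mulVmx ?posdefmx_unit// mul1mx.
by under eq_fun do rewrite dotC dot_deltal !mxE.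
Qed.

End stein_multinormal.

Section stein_row.
Context {R : realType} {d : measure_display} {T : measurableType d}.
Variables (P : probability T R) (n p : nat) (Y : {RV P >-> 'M[R]_(n, p)}).
Variable Sigma : 'M[R]_p.
Hypotheses (pS : posdefmx Sigma) (nY : normal_rows P Y Sigma).

Let mY : measurable_fun setT (Y : T -> 'M[R]_(n, p)).
Proof. exact: measurable_funPT. Qed.

Lemma measurable_row_tr (i : 'I_n) : measurable_fun setT (fun w => (row i (Y w))^T).
Proof.
apply/measurable_mxP => a b; under eq_fun do rewrite !mxE.
by move: i a; apply/measurable_mxP.
Qed.

(** Given the other rows, which are independent of the [i]-th one, this is
    [stein_multinormal] for the [i]-th row. *)
Lemma stein_row (i : 'I_n) (g : 'M[R]_(n, p) -> 'cV[R]_p) (L : 'M[R]_(n, p) -> 'M[R]_p) :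
  testmx g -> testmx L ->
  (forall y (h : 'cV[R]_p),
     mxderiv0 (fun t => g (y + t *: (delta_mx i (0 : 'I_1) *m h^T))) (L y *m h)) ->
  P.-integrable setT (fun w => (dot (row i (Y w))^T (invmx Sigma *m g (Y w)))%:E) /\
  (\int[P]_w (dot (row i (Y w))^T (invmx Sigma *m g (Y w)))%:E =
   \int[P]_w (\tr (L (Y w)))%:E)%E.
Proof.
move=> ng nL dg; have [rowN rowI] := nY.
pose U w : 'cV[R]_p := (row i (Y w))^T.
pose e : 'cV[R]_n := delta_mx i 0.
pose V w : 'M[R]_(n, p) := Y w - e *m (U w)^T.
have mU : measurable_fun setT U := measurable_row_tr i.
have mV : measurable_fun setT V.
  apply: measurable_mxD => //; apply: measurable_mxN; apply: measurable_mulmx => //.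
  exact: measurable_trmx.
have UVE w : V w + e *m (U w)^T = Y w by rewrite /V subrK.
have nU : multinormal P U 0 Sigma := rowN i.
have intD : P.-integrable setT
    (fun w => (dot (U w) (invmx Sigma *m g (Y w)))%:E).
  under eq_fun do rewrite dotE -sumEFin.
  apply: integrable_sum => // k _.
  have ngk : testfun (fun y => (invmx Sigma *m g y) k 0).
    have : testmx (fun y => invmx Sigma *m g y).
      by apply: testmxM => //; exact: testmx_cst.
    by apply.
  have [mgk [C gkC] _] := ngk.
  apply: (@integrable_bounded_mul _ _ _ _ _ _ C) => //.
    have := multinormal_coord_integrable k pS nU.
    have -> : (0 : 'cV[R]_p) k 0 = 0 by rewrite mxE.
    by under eq_fun do rewrite subr0.
  exact: (measurableT_comp mgk mY).
split => //.
have ind : independent P U V.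
  apply: (@independent_rest _ _ _ P _ _ _ (fun i w => (row i (Y w))^T) i) => //.
    exact: measurable_row_tr.
  move=> a b; have [->|ai] := eqVneq a i.
    exists i, (fun=> 0); split; first exact: measurable_cst.
      by move=> w; rewrite /V /U !mxE big_ord1 !mxE !eqxx mul1r subrr.
    by exists 0 => w; rewrite /V /U !mxE big_ord1 !mxE !eqxx mul1r subrr.
  exists a, (fun u : 'cV[R]_p => u b 0); split.
  - exact: measurable_mx_entry.
  - by move=> w; rewrite /V /U !mxE big_ord1 !mxE (negbTE ai) mul0r subr0.
  - by move=> ai'; rewrite ai' eqxx in ai.
pose U_mixin := isMeasurableFun.Build _ _ _ _ _ mU.
pose Up : {mfun T >-> 'cV[R]_p} := HB.pack U U_mixin.
pose V_mixin := isMeasurableFun.Build _ _ _ _ _ mV.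
pose Vp : {mfun T >-> 'M[R]_(n, p)} := HB.pack V V_mixin.
have mphi : measurable_fun setT (fun z : 'cV[R]_p * 'M[R]_(n, p) => z.2 + e *m z.1^T).
  apply: measurable_mxD; first exact: measurable_snd.
  apply: measurable_mulmx; first exact: measurable_cst.
  by apply: measurable_trmx; exact: measurable_fst.
have s (F : 'cV[R]_p * 'M[R]_(n, p) -> R) : measurable_fun setT F ->
    P.-integrable setT (fun w => (F (U w, V w))%:E) ->
    (\int[P]_w (F (U w, V w))%:E =
     \int[distribution P Vp]_y \int[distribution P Up]_t (F (t, y))%:E)%E.
  move=> mF iF.
  apply: (@integral_indep _ _ _ P _ _ _ _ U V mU mV ind
    (distribution P Up) (distribution P Vp) _ _ (fun z => (F z)%:E)) => //.
  exact/measurable_EFinP.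
pose F1 (z : 'cV[R]_p * 'M[R]_(n, p)) := dot z.1 (invmx Sigma *m g (z.2 + e *m z.1^T)).
pose F2 (z : 'cV[R]_p * 'M[R]_(n, p)) := \tr (L (z.2 + e *m z.1^T)).
have F1E w : F1 (U w, V w) = dot (U w) (invmx Sigma *m g (Y w)).
  by rewrite /F1/= UVE.
have F2E w : F2 (U w, V w) = \tr (L (Y w)) by rewrite /F2/= UVE.
have mg : measurable_fun setT g.
  by apply/measurable_mxP => a b; have [] := ng a b.
have mF1 : measurable_fun setT F1.
  apply: (measurableT_comp (measurable_mx_entry 0 0)).
  apply: measurable_mulmx; first by apply: measurable_trmx; exact: measurable_fst.
  apply: measurable_mulmx; first exact: measurable_cst.
  exact: measurableT_comp.
have nphi y (f : 'M[R]_(n, p) -> R) : testfun f -> testfun (fun u : 'cV[R]_p => f (y + e *m u^T)).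
  move=> nf; apply: (testfun_comp nf).
    apply: measurable_mxD; first exact: measurable_cst.
    apply: measurable_mulmx; first exact: measurable_cst.
    by apply: measurable_trmx; exact: measurable_id.
  move=> u h; exists (e *m h^T) => t.
  by rewrite linearD linearZ/= mulmxDr -scalemxAr addrA.
have ntrL : testfun (fun y => \tr (L y)) by exact: testfun_mxtrace.
under eq_integral do rewrite -F1E.
under [RHS]eq_integral do rewrite -F2E.
rewrite (s F1) ?(s F2).
- apply: eq_integral => y _ /=.
  have dgy (u h : 'cV[R]_p) :
      mxderiv0 (fun t => g (y + e *m (u + t *: h)^T)) (L (y + e *m u^T) *m h).
    have := dg (y + e *m u^T) h.
    rewrite (_ : (fun t => g (y + e *m (u + t *: h)^T)) =
      (fun t => g (y + e *m u^T + t *: (e *m h^T))))//.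
    by apply/funext => t; rewrite scalemxAr -addrA -mulmxDr -linearZ -linearD.
  have [iy Ey] := stein_multinormal pS nU
     (fun a b => nphi y _ (ng a b)) (fun a b => nphi y _ (nL a b)) dgy.
  have mpair : measurable_fun setT (fun u : 'cV[R]_p => (u, y)).
    by apply: measurable_fun_pair; [exact: measurable_id|exact: measurable_cst].
  have F1y w : dot (U w - 0) (invmx Sigma *m g (y + e *m (U w)^T)) = F1 (U w, y).
    by rewrite subr0.
  have iF1 : P.-integrable setT ((fun u => (F1 (u, y))%:E) \o Up).
    by move: iy; under eq_fun do rewrite F1y.
  have iF2 : P.-integrable setT ((fun u => (F2 (u, y))%:E) \o Up).
    exact: (testfun_integrable P (nphi y _ ntrL) mU).
  have := Ey; under [X in (X = _)%E -> _]eq_integral do rewrite F1y.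
  move=> Ey'; rewrite (integral_distribution (f := fun u => (F1 (u, y))%:E))//; last first.
    by apply/measurable_EFinP; exact: (measurableT_comp mF1 mpair).
  rewrite (integral_distribution (f := fun u => (F2 (u, y))%:E))//.
  apply/measurable_EFinP; case: ntrL => mtr _ _.
  exact: (measurableT_comp mtr (measurableT_comp mphi mpair)).
- by case: ntrL => mtr _ _; exact: (measurableT_comp mtr mphi).
- under eq_fun do rewrite F2E. exact: (testfun_integrable P ntrL mY).
- exact: mF1.
- by under eq_fun do rewrite F1E.
Qed.

End stein_row.

(** * The vector fields and their divergences *)

Section tik_derivative.
Context {R : realType} {n p : nat} (de : R).
Hypothesis de0 : 0 < de.

Lemma mxderiv0_tik (Y D : 'M[R]_(n, p)) :
  mxderiv0 (fun t => tik de (Y + t *: D))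
    (- (tik de Y *m (D *m Y^T + Y *m D^T) *m tik de Y)).
Proof.
have dK : mxderiv0 (fun t => tikmx de (Y + t *: D)) (D *m Y^T + Y *m D^T).
  have h := mxderiv0D (mxderiv0M (mxderiv0_line Y D) (mxderiv0_tr (mxderiv0_line Y D)))
    (mxderiv0_cst (de%:M : 'M[R]_n)).
  by move: h; rewrite scale0r !addr0.
have h := mxderiv0_invmx (fun t => tikmx_unit de0 (Y + t *: D))
   (fun t => tik_entry de0 (Y + t *: D)) dK.
by move: h; rewrite scale0r addr0.
Qed.

Lemma mxderiv0_tikY (Y D : 'M[R]_(n, p)) :
  mxderiv0 (fun t => tik de (Y + t *: D) *m (Y + t *: D))
    (tik de Y *m D -
     tik de Y *m (D *m Y^T + Y *m D^T) *m tik de Y *m Y).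
Proof.
have h := mxderiv0M (mxderiv0_tik Y D) (mxderiv0_line Y D).
by move: h; rewrite scale0r addr0 addrC mulNmx.
Qed.

Lemma testfun_of_deriv0 (a b : nat) (f : 'M[R]_(a, b) -> R) C :
  measurable_fun setT f -> (forall y, `|f y| <= C) ->
  (forall y h, exists df, deriv0 (fun t => f (y + t *: h)) df) -> testfun f.
Proof.
move=> mf fC df; split => //; first by exists C.
move=> y h t.
have /choice[f' hf'] := fun z => df z h.
exact: is_derive_continuous (is_derive_line hf' y t).
Qed.

Lemma measurable_tik : measurable_fun setT (fun Y : 'M[R]_(n, p) => tik de Y).
Proof.
apply: measurable_invmx; first by move=> Y; exact: tikmx_unit.
apply: measurable_mxD; last exact: measurable_cst.
by apply: measurable_mulmx; [|apply: measurable_trmx]; exact: measurable_id.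
Qed.

Lemma testmx_tik : testmx (fun Y : 'M[R]_(n, p) => tik de Y).
Proof.
move=> i j; apply: (@testfun_of_deriv0 _ _ _ de^-1).
- exact: (measurable_mxP _).2 measurable_tik i j.
- by move=> Y; exact: tik_entry.
- by move=> Y D; eexists; exact: mxderiv0_tik.
Qed.

Lemma testmx_tikY : testmx (fun Y : 'M[R]_(n, p) => tik de Y *m Y).
Proof.
move=> i j; apply: (@testfun_of_deriv0 _ _ _ (1 + de^-1)).
- apply: (measurable_mxP _).2; apply: measurable_mulmx => //.
  exact: measurable_tik.
- by move=> Y; exact: tikY_entry.
- by move=> Y D; eexists; exact: mxderiv0_tikY.
Qed.

Lemma testmx_smoother : testmx (fun Y : 'M[R]_(n, p) => Y^T *m tik de Y *m Y).
Proof.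
move=> i j; apply: (@testfun_of_deriv0 _ _ _ 1).
- apply: (measurable_mxP _).2; apply: measurable_mulmx => //.
  apply: measurable_mulmx; last exact: measurable_tik.
  exact: measurable_trmx.
- by move=> Y; exact: smoother_entry.
- move=> Y D; eexists.
  exact: (mxderiv0M (mxderiv0M (mxderiv0_tr (mxderiv0_line Y D)) (mxderiv0_tik Y D)) (mxderiv0_line Y D)).
Qed.

Lemma deriv0_dot (W : R -> 'cV[R]_n) dW : mxderiv0 W dW ->
  deriv0 (fun t => dot (W t) (W t)) (2 * dot (W 0) dW).
Proof.
move=> hW; have h := mxderiv0M (mxderiv0_tr hW) hW.
have := h 0 0; rewrite mxE -/(dot dW (W 0)) -/(dot (W 0) dW) dotC.
by rewrite -mulr2n mulr_natl.
Qed.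

Variable ep : R.
Hypothesis ep0 : 0 < ep.

Lemma dot_ep_gt0 m (W : 'cV[R]_m) : 0 < dot W W + ep.
Proof. by rewrite ltr_wpDl// dot_ge0. Qed.

Lemma deriv0_inv_dot (W : R -> 'cV[R]_n) dW : mxderiv0 W dW ->
  deriv0 (fun t => (dot (W t) (W t) + ep)^-1)
    (- (dot (W 0) (W 0) + ep) ^- 2 * (2 * dot (W 0) dW)).
Proof.
move=> hW; apply: deriv0V; first by move=> t; rewrite gt_eqF// dot_ep_gt0.
by rewrite -[2 * _]addr0; apply: deriv0D; [exact: deriv0_dot|exact: deriv0_cst].
Qed.

End tik_derivative.

Section shrinkage_field.
Context {R : realType} {n p : nat} (de ep : R).
Hypotheses (de0 : 0 < de) (ep0 : 0 < ep).
Implicit Types (Y : 'M[R]_(n, p)) (x : 'cV[R]_p).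

(** As [de] and [ep] tend to 0, [wvec Y x], [vvec Y x] and [cfac Y x] tend to
    [(Y^+)' x], [S S^+ x] and [1 / (x' S^+ x)] for [S = Y' Y], if [x' S^+ x] is not
    0. *)
Definition wvec Y x : 'cV[R]_n := tik de Y *m Y *m x.
Definition vvec Y x : 'cV[R]_p := Y^T *m wvec Y x.
Definition cfac Y x : R := (dot (wvec Y x) (wvec Y x) + ep)^-1.

Lemma cfac_gt0 Y x : 0 < cfac Y x.
Proof. by rewrite invr_gt0 dot_ep_gt0. Qed.

Lemma cfac_le Y x : cfac Y x <= ep^-1.
Proof. by rewrite lef_pV2 ?posrE ?dot_ep_gt0// lerDr dot_ge0. Qed.

Lemma cfac_dot Y x : cfac Y x * dot (wvec Y x) (wvec Y x) <= 1.
Proof.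
rewrite mulrC ler_pdivrMr ?dot_ep_gt0// mul1r lerDl.
exact: ltW.
Qed.

Definition shrink Y x : 'cV[R]_p := cfac Y x *: vvec Y x.
Definition shrink_jac Y x : 'M[R]_p := cfac Y x *: (Y^T *m tik de Y *m Y) -
  vvec Y x *m ((2 * cfac Y x ^+ 2) *: ((wvec Y x)^T *m (tik de Y *m Y))).

Lemma mxderiv0_shrink Y x h : mxderiv0 (fun t => shrink Y (x + t *: h)) (shrink_jac Y x *m h).
Proof.
have dW : mxderiv0 (fun t => wvec Y (x + t *: h)) (tik de Y *m Y *m h).
  have d := mxderiv0M (mxderiv0_cst (tik de Y *m Y)) (mxderiv0_line x h).
  by move: d; rewrite mul0mx add0r.
have dv : mxderiv0 (fun t => vvec Y (x + t *: h)) (Y^T *m (tik de Y *m Y *m h)).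
  have d := mxderiv0M (mxderiv0_cst Y^T) dW.
  by move: d; rewrite mul0mx add0r.
apply: mxderiv0_eq (mxderiv0Z (deriv0_inv_dot ep0 dW) dv) _.
rewrite scale0r addr0 -/(cfac Y x) /shrink_jac mulmxBl addrC; congr (_ + _).
  by rewrite -scalemxAl !mulmxA.
have e : (wvec Y x)^T *m (tik de Y *m Y) *m h =
    (dot (wvec Y x) (tik de Y *m Y *m h))%:M.
  by rewrite -mulmxA [LHS]mx11_scalar.
rewrite -scalemxAr -scalemxAl -(mulmxA (vvec Y x)) e mul_mx_scalar scalerA -scaleNr.
congr (_ *: _).
by rewrite -exprVn -/(cfac Y x); ring.
Qed.

(** The trace of [Y' M Y] is [n - de tr M] for [M = tik de Y]; the second term of
    the Jacobian comes from the derivative of [cfac] and has trace at most [2 cfac]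
    because [cfac * |W|^2 <= 1]. *)
Lemma tr_shrink_jac_ge Y x :
  (n%:R - 2 - de * tikabs de Y) * cfac Y x <= \tr (shrink_jac Y x).
Proof.
rewrite /shrink_jac linearB/= mxtraceZ mxtrace_smoother// -scalemxAr mxtraceZ.
rewrite mxtrace_mulC /vvec trace_mx11 -mulmxA mulmxA.
set W := wvec Y x; set c := cfac Y x.
have -> : (W^T *m (tik de Y *m Y) *m (Y^T *m W)) 0 0 =
    dot W W - de * dot W (tik de Y *m W).
  by rewrite -!mulmxA (mulmxA (tik de Y)) -/(dot _ _) mulmxA -(mulmxA (tik de Y))
    tik_gram// mulmxBl mul1mx dotBr -scalemxAl dotZr.
have t1 := tr_tik_le de Y; have t2 := tik_ge0 de0 Y W.
have c0 : 0 < c := cfac_gt0 _ _; have c1 : c * dot W W <= 1 := cfac_dot _ _.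
move: (\tr _) (dot W (_ *m W)) (tikabs de Y) (dot W W) t1 t2 c1 => T Q m q t1 t2 c1.
(* the difference of the two sides as a sum of nonnegative terms *)
suff : 0 <= c * (de * (m - T)) + 2 * c * (1 - c * q) + 2 * c ^+ 2 * de * Q by lra.
have k2 : 0 <= 1 - c * q by rewrite subr_ge0.
have c0' := ltW c0; have de0' := ltW de0.
by rewrite !addr_ge0// !mulr_ge0// subr_ge0.
Qed.

End shrinkage_field.

Section row_fields.
Context {R : realType} {n p : nat} (de ep : R).
Hypotheses (de0 : 0 < de) (ep0 : 0 < ep).
Implicit Types (Y : 'M[R]_(n, p)) (x : 'cV[R]_p).
Local Notation wvec := (wvec de).
Local Notation vvec := (vvec de).
Local Notation cfac := (cfac de ep).

Section field_of_x.
Variable Y : 'M[R]_(n, p).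

Let dW (x h : 'cV[R]_p) : mxderiv0 (fun t => wvec Y (x + t *: h)) (tik de Y *m Y *m h).
Proof.
have d := mxderiv0M (mxderiv0_cst (tik de Y *m Y)) (mxderiv0_line x h).
by move: d; rewrite mul0mx add0r.
Qed.

Let mW : measurable_fun setT (wvec Y).
Proof. by apply: measurable_mulmx => //; exact: measurable_cst. Qed.

Let mc : measurable_fun setT (cfac Y).
Proof.
apply: measurable_fun_inv; apply: measurable_funD => //.
apply: (measurableT_comp (measurable_mx_entry 0 0)).
by apply: measurable_mulmx => //; exact: measurable_trmx.
Qed.

Lemma testfun_cfac_x : testfun (cfac Y).
Proof.
apply: (@testfun_of_deriv0 _ _ _ _ ep^-1) => //.
- by move=> x; rewrite ger0_norm ?cfac_le// ltW// cfac_gt0.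
- by move=> x h; have d := deriv0_inv_dot ep0 (dW x h); eexists; exact: d.
Qed.

(** [wvec Y] is linear in [x]; the factor makes it bounded. *)
Lemma testmx_cwvec_x : testmx (fun x => cfac Y x *: wvec Y x).
Proof.
move=> i j; rewrite (ord1 j); under eq_fun do rewrite mxE.
apply: (@testfun_of_deriv0 _ _ _ _ (1 + ep^-1)) => //.
- apply: measurable_funM => //.
  exact: (measurable_mxP _).2 mW i 0.
- move=> x; apply: norm_le_sqr.
  rewrite exprMn expr2 -mulrA (le_trans _ (cfac_le de ep0 Y x))//.
  rewrite ler_piMr// ?(ltW (cfac_gt0 _ _ _ _))//.
  apply: le_trans (cfac_dot de ep0 Y x).
  by rewrite ler_wpM2l ?sqr_le_dot// ltW// cfac_gt0.
- move=> x h; eexists.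
  exact: (deriv0M (deriv0_inv_dot ep0 (dW x h)) (dW x h i 0)).
Qed.

Lemma testmx_shrink : testmx (shrink de ep Y).
Proof.
rewrite (_ : shrink de ep Y = (fun x => Y^T *m (cfac Y x *: wvec Y x))).
  by apply: testmxM; [exact: testmx_cst|exact: testmx_cwvec_x].
by apply/funext => x; rewrite /shrink scalemxAr.
Qed.

Lemma testmx_shrink_jac : testmx (shrink_jac de ep Y).
Proof.
rewrite (_ : shrink_jac de ep Y = (fun x => cfac Y x *: (Y^T *m tik de Y *m Y) -
  (Y^T *m (cfac Y x *: wvec Y x)) *m
  ((cfac Y x *: wvec Y x)^T *m (2 *: (tik de Y *m Y))))).
  apply: testmxB.
    by apply: testmxZ; [exact: testfun_cfac_x|exact: testmx_cst].
  apply: testmxM; apply: testmxM; try exact: testmx_cst.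
    exact: testmx_cwvec_x.
  by apply: testmx_tr; exact: testmx_cwvec_x.
apply/funext => x; rewrite /shrink_jac; congr (_ - _).
have -> : (cfac Y x *: wvec Y x)^T = cfac Y x *: (wvec Y x)^T by rewrite linearZ.
rewrite -!scalemxAr -!scalemxAl -?scalemxAr !scalerA.
by congr (_ *: _); ring.
Qed.

End field_of_x.

Section Y_part.
Variable x : 'cV[R]_p.

(** The Jacobian of [wvec] with respect to the [i]-th row of [Y]. *)
Definition wvec_jac (i : 'I_n) Y : 'M[R]_(n, p) :=
  tik de Y *m delta_mx i 0 *m (x - vvec Y x)^T - wvec Y x i 0 *: (tik de Y *m Y).

(** The scalar products of these fields with [Sigma^-1] times the rows of [Y] add up
    to the quadratic term of the loss, see [sum_dot_quad_field]. *)
Definition quad_field (i : 'I_n) Y : 'cV[R]_p :=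
  (wvec Y x i 0 * cfac Y x ^+ 2) *: vvec Y x.

Definition quad_jac (i : 'I_n) Y : 'M[R]_p :=
  vvec Y x *m (cfac Y x ^+ 2 *: row i (wvec_jac i Y) -
     (4 * cfac Y x ^+ 3 * wvec Y x i 0) *: ((wvec Y x)^T *m wvec_jac i Y)) +
  (wvec Y x i 0 * cfac Y x ^+ 2) *: ((wvec Y x i 0)%:M + Y^T *m wvec_jac i Y).

Lemma mxderiv0_wvec i Y (h : 'cV[R]_p) :
  mxderiv0 (fun t => wvec (Y + t *: (delta_mx i (0 : 'I_1) *m h^T)) x) (wvec_jac i Y *m h).
Proof.
have d := mxderiv0M (mxderiv0_tikY de0 Y (delta_mx i (0 : 'I_1) *m h^T)) (mxderiv0_cst x).
apply: mxderiv0_eq d _.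
rewrite mulmx0 addr0 /wvec_jac !mulmxBl mulmxDr !mulmxDl.
set M := tik de Y.
have -> : M *m (delta_mx i 0 *m h^T) *m x = M *m delta_mx i 0 *m (h^T *m x).
  by rewrite !mulmxA.
have -> : M *m (delta_mx i 0 *m h^T *m Y^T) *m M *m Y *m x =
   M *m delta_mx i 0 *m (h^T *m vvec Y x) by rewrite /vvec /wvec !mulmxA.
have -> : M *m (Y *m (delta_mx i 0 *m h^T)^T) *m M *m Y *m x =
   M *m Y *m h *m ((delta_mx i 0)^T *m wvec Y x).
  by rewrite trmx_mul trmxK /wvec !mulmxA.
rewrite opprD addrA -mulmxBr -mulmxBr; congr (_ - _).
  rewrite -[RHS]mulmxA; congr (_ *m _).
  by rewrite [LHS]mx11_scalar [RHS]mx11_scalar -/(dot _ _) dotC.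
rewrite [_^T *m wvec Y x]mx11_scalar -/(dot _ _) dot_deltal mul_mx_scalar.
by rewrite -scalemxAl.
Qed.

Lemma mxderiv0_quad_field i Y (h : 'cV[R]_p) :
  mxderiv0 (fun t => quad_field i (Y + t *: (delta_mx i (0 : 'I_1) *m h^T))) (quad_jac i Y *m h).
Proof.
have dW := mxderiv0_wvec i Y h.
have dv := mxderiv0M (mxderiv0_tr (mxderiv0_line Y (delta_mx i (0 : 'I_1) *m h^T))) dW.
have dc := deriv0_inv_dot ep0 dW.
have dk := deriv0M (dW i 0) (deriv0M dc dc).
apply: mxderiv0_eq (mxderiv0Z dk dv) _.
rewrite scale0r addr0 -/(cfac Y x) -/(vvec Y x).
rewrite -exprVn -/(cfac Y x) /quad_jac.
set c := cfac Y x; set W := wvec Y x; set v := vvec Y x.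
rewrite mulmxDl; congr (_ + _); last first.
  rewrite -scalemxAl -expr2; congr (_ *: _).
  rewrite trmx_mul trmxK [RHS]mulmxDl mul_scalar_mx -[in LHS]mulmxA -[in RHS]mulmxA; congr (_ + _).
  by rewrite [_^T *m W]mx11_scalar -/(dot _ _) dot_deltal mul_mx_scalar.
have e1 (A B : 'rV[R]_p) : v *m (A - B) *m h = v *m (A *m h - B *m h).
  by rewrite -mulmxA mulmxBl.
rewrite e1 -!scalemxAl.
have -> : W^T *m wvec_jac i Y *m h = (dot W (wvec_jac i Y *m h))%:M.
  by rewrite -mulmxA [LHS]mx11_scalar.
have -> : row i (wvec_jac i Y) *m h = ((wvec_jac i Y *m h) i 0)%:M.
  by rewrite [LHS]mx11_scalar -row_mul mxE.
rewrite mulmxBr -!scalemxAr !mul_mx_scalar !scalerA -scalerBl; congr (_ *: _).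
by ring.
Qed.

Lemma testmx_wvec : testmx (fun Y => wvec Y x).
Proof. by apply: testmxM; [exact: testmx_tikY|exact: testmx_cst]. Qed.

Lemma testmx_vvec : testmx (fun Y => vvec Y x).
Proof.
rewrite (_ : (fun Y => _) = (fun Y => Y^T *m tik de Y *m Y *m x)).
  by apply: testmxM; [exact: testmx_smoother|exact: testmx_cst].
by apply/funext => Y; rewrite /vvec /wvec !mulmxA.
Qed.

Lemma testfun_cfac : testfun (fun Y => cfac Y x).
Proof.
apply: (@testfun_of_deriv0 _ _ _ _ ep^-1) => //.
- apply: measurable_fun_inv; apply: measurable_funD => //.
  have mW : measurable_fun setT (fun Y => wvec Y x).
    by apply/measurable_mxP => i j; have [] := testmx_wvec i j.
  apply: (measurableT_comp (measurable_mx_entry 0 0)).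
  by apply: measurable_mulmx => //; exact: measurable_trmx.
- by move=> Y; rewrite ger0_norm ?cfac_le// ltW// cfac_gt0.
- move=> Y D; eexists; apply: (deriv0_inv_dot ep0).
  exact: mxderiv0M (mxderiv0_tikY de0 Y D) (mxderiv0_cst x).
Qed.

Lemma testmx_quad_field i : testmx (quad_field i).
Proof.
apply: testmxZ; last exact: testmx_vvec.
apply: testfunM; first exact: testmx_wvec.
by rewrite (_ : (fun y => _) = (fun y => cfac y x * cfac y x)) //; apply: testfunM; exact: testfun_cfac.
Qed.

Lemma testmx_quad_jac i : testmx (quad_jac i).
Proof.
have nc := testfun_cfac; have nW := testmx_wvec; have nv := testmx_vvec.
have nM := @testmx_tik R n p de de0; have nA := @testmx_tikY R n p de de0.
have nc2 : testfun (fun Y => cfac Y x ^+ 2).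
  by under eq_fun do rewrite expr2; exact: testfunM.
have nD : testmx (wvec_jac i).
  apply: testmxB; last by apply: testmxZ => //; exact: nW.
  apply: testmxM; first by apply: testmxM => //; exact: testmx_cst.
  by apply: testmx_tr; apply: testmxB => //; exact: testmx_cst.
have nYD : testmx (fun Y => Y^T *m wvec_jac i Y).
  rewrite (_ : (fun Y => _) = (fun Y => (tik de Y *m Y)^T *m delta_mx i 0 *m (x - vvec Y x)^T
     - wvec Y x i 0 *: (Y^T *m tik de Y *m Y))).
    apply: testmxB; last first.
      by apply: testmxZ; [exact: nW|exact: testmx_smoother].
    apply: testmxM.
      by apply: testmxM; [exact: testmx_tr|exact: testmx_cst].
    by apply: testmx_tr; apply: testmxB => //; exact: testmx_cst.
  apply/funext => Y; rewrite /wvec_jac mulmxBr; congr (_ - _).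
    by rewrite trmx_mul tik_sym// !mulmxA.
  by rewrite -scalemxAr mulmxA.
apply: testmxD.
  apply: testmxM => //; apply: testmxB.
    apply: testmxZ => // a b; under eq_fun do rewrite mxE; exact: nD.
  apply: testmxZ.
    apply: testfunM; last exact: nW.
    apply: testfunM; first exact: testfun_cst.
    by under eq_fun do rewrite exprS; exact: testfunM.
  by apply: testmxM => //; exact: testmx_tr.
apply: testmxZ; first by apply: testfunM => //; exact: nW.
apply: testmxD => //.
move=> a b; under eq_fun do rewrite mxE -mulr_natr.
by apply: testfunM; [exact: nW|exact: testfun_cst].
Qed.

End Y_part.
End row_fields.

Section traces.
Context {R : realType} {n p : nat} (de ep : R).
Hypotheses (de0 : 0 < de) (ep0 : 0 < ep).
Implicit Types (Y : 'M[R]_(n, p)) (x : 'cV[R]_p).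
Local Notation wvec := (wvec de).
Local Notation vvec := (vvec de).
Local Notation cfac := (cfac de ep).

Section traces_Y.
Variables (x : 'cV[R]_p) (Y : 'M[R]_(n, p)).
Let M := tik de Y.
Let W := wvec Y x.
Let v := vvec Y x.
Let c := cfac Y x.
Let q := dot W W.
Let Q := dot W (M *m W).
Let T := \tr M.

Lemma wvec_jac_v i : wvec_jac de x i Y *m v =
  (de * q) *: (M *m delta_mx i 0) - W i 0 *: (W - de *: (M *m W)).
Proof.
rewrite /wvec_jac mulmxBl -scalemxAl tik_Y_v//; congr (_ - _).
rewrite -[LHS]mulmxA [_^T *m v]mx11_scalar -/(dot _ _) dotC dot_residual//.
by rewrite mul_mx_scalar.
Qed.

Lemma dot_W_tik i : dot W (M *m delta_mx i 0) = (M *m W) i 0.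
Proof. by rewrite dotC dot_mull tik_sym dot_deltal. Qed.

Lemma tr_Y_wvec_jac i : \tr (Y^T *m wvec_jac de x i Y) =
  de * (M *m W) i 0 - W i 0 * (n%:R - de * T).
Proof.
rewrite /wvec_jac mulmxBr linearB/= -scalemxAr mxtraceZ (mulmxA Y^T (tik de Y) Y).
rewrite mxtrace_smoother//; congr (_ - _); rewrite mulmxA mxtrace_dot.
rewrite dotC dot_mull trmxK dotC mulmx_residual// dotZl.
by rewrite dot_W_tik.
Qed.

Lemma tr_outer (D : 'M[R]_(n, p)) (u : 'cV[R]_p) (w : 'cV[R]_n) (r s : R) i :
  \tr (u *m (r *: row i D - s *: (w^T *m D))) =
  r * (D *m u) i 0 - s * dot w (D *m u).
Proof.
rewrite mulmxBr mxtraceD -!scalemxAr -scaleNr !mxtraceZ mulNr.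
by congr (_ * _ - _ * _); rewrite mxtrace_mulC trace_mx11;
  [rewrite -row_mul mxE|rewrite -mulmxA].
Qed.

Lemma tr_quad_jac i : \tr (quad_jac de ep x i Y) =
  c ^+ 2 * (de * q * M i i - W i 0 * (W i 0 - de * (M *m W) i 0)) -
  4 * c ^+ 3 * W i 0 * (de * q * (M *m W) i 0 - W i 0 * (q - de * Q)) +
  W i 0 * c ^+ 2 * (p%:R * W i 0 + (de * (M *m W) i 0 - W i 0 * (n%:R - de * T))).
Proof.
rewrite /quad_jac mxtraceD mxtraceZ mxtraceD mxtrace_scalar tr_Y_wvec_jac -[_ *+ p]mulr_natl.
congr (_ + _).
rewrite tr_outer wvec_jac_v dotBr !dotZr dotBr dotZr dot_W_tik; congr (_ * _ - _).
by rewrite -(mul_delta M) !mxE.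
Qed.

Lemma sum_tr_quad_jac : \sum_i \tr (quad_jac de ep x i Y) =
  c ^+ 2 * ((p%:R - n%:R - 1) * q + 2 * de * T * q + 2 * de * Q) +
  4 * c ^+ 3 * q ^+ 2 - 8 * c ^+ 3 * de * q * Q.
Proof.
have qE : q = \sum_i W i 0 * W i 0 by rewrite /q dotE.
have QE : Q = \sum_i W i 0 * (M *m W) i 0 by rewrite /Q dotE.
have TE : T = \sum_i M i i by [].
(* the coefficients of tr M, |W|^2 and W'MW once the terms are regrouped *)
pose k1 := c ^+ 2 * de * q.
pose k2 := - c ^+ 2 + 4 * c ^+ 3 * (q - de * Q) + c ^+ 2 * (p%:R - n%:R + de * T).
pose k3 := 2 * c ^+ 2 * de - 4 * c ^+ 3 * de * q.
transitivity (k1 * T + k2 * q + k3 * Q); last by rewrite /k1 /k2 /k3; ring.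
rewrite [in RHS]TE [in X in _ + _ * X + _]qE [in X in _ + _ * X]QE.
rewrite !mulr_sumr -!big_split/=; apply: eq_bigr => i _.
by rewrite tr_quad_jac /k1 /k2 /k3; ring.
Qed.

(** With [q = |W|^2] and [c = cfac], the leading terms [(p - n - 1) c^2 q] and
    [4 c^3 q^2] are at most [(p - n - 1) c] and [4 c], by [0 <= c q <= 1] and
    [n < p]. *)
Lemma sum_tr_quad_jac_le : (n < p)%N -> \sum_i \tr (quad_jac de ep x i Y) <=
  (p%:R - n%:R + 3 + 4 * de * tikabs de Y) * c.
Proof.
move=> np; rewrite sum_tr_quad_jac.
have t1 := tr_tik_le de Y; have t2 := tik_ge0 de0 Y W.
have t3 := dot_tik_le de Y W; have t4 := tikabs_ge0 de Y.
have c0 : 0 < c := cfac_gt0 de ep0 _ _; have c1 : c * dot W W <= 1 := cfac_dot _ ep0 _ _.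
have q0 := dot_ge0 W.
have d1 : 0 <= p%:R - n%:R - 1 :> R by rewrite -addrA -opprD subr_ge0 natr1 ler_nat.
rewrite -/M -/W -/Q -/q -/T -/c in t1 t2 t3 t4 c0 c1 q0 *.
have c0' := ltW c0; have de0' := ltW de0.
have k : p%:R - n%:R = (p%:R - n%:R - 1) + 1 :> R by rewrite subrK.
rewrite k; move: (tikabs de Y) T Q q (p%:R - n%:R - 1) t1 t2 t3 t4 c1 q0 d1.
move=> m T' Q' q' r t1 t2 t3 t4 c1 q0 d1.
have u0 : 0 <= 1 - c * q' by rewrite subr_ge0.
have cq0 : 0 <= c * q' by rewrite mulr_ge0.
(* the difference of the two sides as a sum of nonnegative terms *)
suff : 0 <= c * (r + 2 * de * m) * (1 - c * q') +
   2 * de * c * (c * q') * (m - T') +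
   2 * de * c ^+ 2 * (m * q' - Q') + 2 * de * m * c * (1 - c * q') +
   4 * c * (1 - c * q') * (1 + c * q') + 8 * c ^+ 2 * de * (c * q') * Q' by lra.
have v1 : 0 <= m - T' by rewrite subr_ge0.
have v2 : 0 <= m * q' - Q' by rewrite subr_ge0.
have v3 : 0 <= 1 + c * q' by rewrite addr_ge0.
have v4 : 0 <= r + 2 * de * m by rewrite addr_ge0// !mulr_ge0.
have v5 : 0 <= c ^+ 2 by rewrite exprn_ge0.
have h1 : 0 <= c * (r + 2 * de * m) * (1 - c * q') by rewrite mulr_ge0// mulr_ge0.
have h2 : 0 <= 2 * de * c * (c * q') * (m - T').
  by rewrite mulr_ge0// mulr_ge0// mulr_ge0// mulr_ge0.
have h3 : 0 <= 2 * de * c ^+ 2 * (m * q' - Q').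
  by rewrite mulr_ge0// mulr_ge0// mulr_ge0.
have h4 : 0 <= 2 * de * m * c * (1 - c * q').
  by rewrite mulr_ge0// mulr_ge0// mulr_ge0// mulr_ge0.
have h5 : 0 <= 4 * c * (1 - c * q') * (1 + c * q').
  by rewrite mulr_ge0// mulr_ge0// mulr_ge0.
have h6 : 0 <= 8 * c ^+ 2 * de * (c * q') * Q'.
  by rewrite mulr_ge0// mulr_ge0// mulr_ge0// mulr_ge0.
by rewrite !addr_ge0.
Qed.

Lemma sum_dot_quad_field (S : 'M[R]_p) :
  \sum_i dot (row i Y)^T (S *m quad_field de ep x i Y) = c ^+ 2 * dot v (S *m v).
Proof.
rewrite /v {2}/vvec dot_mull trmxK -/W dotE mulr_sumr; apply: eq_bigr => i _.
have -> : dot (row i Y)^T (S *m quad_field de ep x i Y) =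
    W i 0 * c ^+ 2 * (Y *m (S *m v)) i 0.
  by rewrite /quad_field -scalemxAr dotZr; congr (_ * _); rewrite /dot trmxK -row_mul mxE.
by rewrite -/W; ring.
Qed.

End traces_Y.

(** Fields that control the size of [tik de Y] in mean: their divergence contains
    [de * \tr (tik de Y *m tik de Y)], whereas their scalar products with the rows
    of [Y] stay bounded. *)
Definition lin_field (i : 'I_n) Y : 'cV[R]_p := Y^T *m tik de Y *m delta_mx i 0.

Definition lin_jac (i : 'I_n) Y : 'M[R]_p :=
  (tik de Y i i)%:M - lin_field i Y *m (lin_field i Y)^T - tik de Y i i *: (Y^T *m tik de Y *m Y).

Lemma mxderiv0_lin_field i Y (h : 'cV[R]_p) :
  mxderiv0 (fun t => lin_field i (Y + t *: (delta_mx i (0 : 'I_1) *m h^T))) (lin_jac i Y *m h).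
Proof.
have d := mxderiv0M (mxderiv0M (mxderiv0_tr (mxderiv0_line Y (delta_mx i (0 : 'I_1) *m h^T)))
  (mxderiv0_tik de0 Y (delta_mx i (0 : 'I_1) *m h^T))) (mxderiv0_cst (delta_mx i (0 : 'I_1))).
apply: mxderiv0_eq d _.
rewrite scale0r addr0 mulmx0 addr0 trmx_mul trmxK.
set e := delta_mx i 0; set M := tik de Y.
have Mii : e^T *m M *m e = (M i i)%:M.
  by rewrite -mulmxA [LHS]mx11_scalar -/(dot _ _) dot_deltal mul_delta.
have eE (A B : 'M[R]_p) : (A - B) *m h = A *m h - B *m h by rewrite mulmxBl.
rewrite /lin_jac !eE mul_scalar_mx -scalemxAl.
have -> : (h *m e^T *m M + Y^T *m - (M *m (e *m h^T *m Y^T + Y *m (h *m e^T)) *m M)) *m e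
   = h *m (e^T *m M *m e) - Y^T *m M *m e *m (h^T *m Y^T *m M *m e)
     - Y^T *m M *m Y *m h *m (e^T *m M *m e).
  rewrite !(mulmxN, mulNmx, mulmxDr, mulmxDl, opprD).
  by rewrite !mulmxA addrA.
have -> : h^T *m Y^T *m M *m e = (lin_field i Y)^T *m h.
  rewrite [LHS]mx11_scalar [RHS]mx11_scalar -/(dot _ _) dotC.
  by rewrite /dot /lin_field !mulmxA.
by rewrite Mii !mul_mx_scalar mulmxA.
Qed.

Lemma testmx_lin_field i : testmx (lin_field i).
Proof.
rewrite (_ : lin_field i = (fun Y => (tik de Y *m Y)^T *m delta_mx i 0)).
  by apply: testmxM; [apply: testmx_tr; exact: testmx_tikY|exact: testmx_cst].
by apply/funext => Y; rewrite /lin_field trmx_mul tik_sym.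
Qed.

Lemma testmx_lin_jac i : testmx (lin_jac i).
Proof.
have nM := @testmx_tik R n p de de0; have nE := testmx_lin_field i.
apply: testmxB; last by apply: testmxZ; [exact: nM|exact: testmx_smoother].
apply: testmxB; last by apply: testmxM => //; exact: testmx_tr.
move=> a b; under eq_fun do rewrite mxE -mulr_natr.
by apply: testfunM; [exact: nM|exact: testfun_cst].
Qed.

Lemma sum_tr_lin_jac Y : \sum_i \tr (lin_jac i Y) =
  (p%:R - n%:R - 1) * \tr (tik de Y) + de * \tr (tik de Y *m tik de Y)
  + de * \tr (tik de Y) ^+ 2.
Proof.
have gg : \sum_i dot (lin_field i Y) (lin_field i Y) =
    \tr (tik de Y) - de * \tr (tik de Y *m tik de Y).
  transitivity (\tr (tik de Y *m (Y *m Y^T) *m tik de Y)); last first.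
    by rewrite tik_gram// mulmxBl mul1mx -scalemxAl linearB/= mxtraceZ.
  apply: eq_bigr => i _; rewrite /lin_field -mulmxA dot_mull trmxK dot_mull tik_sym//.
  by rewrite dot_deltal !mulmxA mul_delta.
have trE i : \tr (lin_jac i Y) = p%:R * tik de Y i i - dot (lin_field i Y) (lin_field i Y) -
    tik de Y i i * (n%:R - de * \tr (tik de Y)).
  rewrite /lin_jac linearB/= linearB/= mxtraceZ mxtrace_smoother// mxtrace_scalar.
  by rewrite mxtrace_dot -[_ *+ p]mulr_natl.
under eq_bigr do rewrite trE.
rewrite !sumrB gg -mulr_sumr -mulr_suml -/(\tr (tik de Y)); ring.
Qed.

(** The sum is the trace of [S *m (Y' M Y)], and [Y' M Y] is a contraction. *)
Lemma sum_dot_lin_field_le (S : 'M[R]_p) Y :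
  \sum_i dot (row i Y)^T (S *m lin_field i Y) <= \sum_i \sum_j `|S i j|.
Proof.
have -> : \sum_i dot (row i Y)^T (S *m lin_field i Y) = \tr (S *m (Y^T *m tik de Y *m Y)).
  rewrite mulmxA mxtrace_mulC; apply: eq_bigr => i _.
  by rewrite /dot trmxK -row_mul mxE -[RHS]mul_delta /lin_field !mulmxA.
rewrite ler_sum// => i _; rewrite mxE ler_sum// => j _.
rewrite (le_trans (ler_norm _))// normrM ler_piMr//.
exact: smoother_entry.
Qed.

End traces.

(** * Expected divergences *)

Section expected_divergence.
Context {R : realType} {n p : nat} (de ep : R).
Hypotheses (de0 : 0 < de) (ep0 : 0 < ep).
Variable Sigma : 'M[R]_p.
Hypothesis pS : posdefmx Sigma.

Section cross_term.
Context {d : measure_display} {T : measurableType d} (P : probability T R).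
Variables (X : {RV P >-> 'cV[R]_p}) (theta : 'cV[R]_p).
Hypothesis nX : multinormal P X theta Sigma.

Lemma expected_cross_ge (Y : 'M[R]_(n, p)) :
  P.-integrable setT (fun w =>
     (dot (X w - theta) (invmx Sigma *m shrink de ep Y (X w)))%:E) /\
  (\int[P]_w ((n%:R - 2 - de * tikabs de Y) * cfac de ep Y (X w))%:E <=
   \int[P]_w (dot (X w - theta) (invmx Sigma *m shrink de ep Y (X w)))%:E)%E.
Proof.
have [iX eX] := stein_multinormal pS nX (testmx_shrink de ep0 Y) (testmx_shrink_jac de ep0 Y)
  (mxderiv0_shrink de ep0 Y).
split=> //; rewrite eX.
have mX : measurable_fun setT (X : T -> 'cV[R]_p) by exact: measurable_funPT.
apply: le_integral => //.
- apply: (testfun_integrable P _ mX (f := fun x => (n%:R - 2 - de * tikabs de Y) * cfac de ep Y x)).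
  by apply: testfunM; [exact: testfun_cst|exact: testfun_cfac_x].
- by apply: (testfun_integrable P (testfun_mxtrace (testmx_shrink_jac de ep0 Y)) mX).
- by move=> w _; rewrite lee_fin tr_shrink_jac_ge.
Qed.

End cross_term.

Section quadratic_term.
Context {d : measure_display} {T : measurableType d} (P : probability T R).
Variable Y : {RV P >-> 'M[R]_(n, p)}.
Hypothesis nY : normal_rows P Y Sigma.
Hypothesis np : (n < p)%N.

Let mY : measurable_fun setT (Y : T -> 'M[R]_(n, p)).
Proof. exact: measurable_funPT. Qed.

Lemma tikabs_le (M : 'M[R]_(n, p)) : tikabs de M <= n%:R * n%:R * de^-1.
Proof.
have h : tikabs de M <= \sum_(i < n) \sum_(j < n) de^-1.
  by apply: ler_sum => i _; apply: ler_sum => j _; exact: tik_entry.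
rewrite (le_trans h)//.
by rewrite sumr_const sumr_const !card_ord -mulrnA -[leLHS]mulr_natl natrM.
Qed.

Lemma measurable_tikabs : measurable_fun setT (fun M : 'M[R]_(n, p) => tikabs de M).
Proof.
rewrite /tikabs; apply: measurable_sum => i; apply: measurable_sum => j.
apply: measurableT_comp => //.
by have [] := testmx_tik de0 (n := n) (p := p) i j.
Qed.

Lemma sum_stein_row (g : 'I_n -> 'M[R]_(n, p) -> 'cV[R]_p)
    (L : 'I_n -> 'M[R]_(n, p) -> 'M[R]_p) :
  (forall i, testmx (g i)) -> (forall i, testmx (L i)) ->
  (forall i y (h : 'cV[R]_p),
     mxderiv0 (fun t => g i (y + t *: (delta_mx i (0 : 'I_1) *m h^T))) (L i y *m h)) ->
  P.-integrable setT (fun w => (\sum_i dot (row i (Y w))^T (invmx Sigma *m g i (Y w)))%:E) /\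
  (\int[P]_w (\sum_i dot (row i (Y w))^T (invmx Sigma *m g i (Y w)))%:E =
   \int[P]_w (\sum_i \tr (L i (Y w)))%:E)%E.
Proof.
move=> ng nL dg.
have sr i := stein_row pS nY (ng i) (nL i) (dg i).
have E : (fun w => (\sum_i dot (row i (Y w))^T (invmx Sigma *m g i (Y w)))%:E) =
  (fun w => \sum_i (dot (row i (Y w))^T (invmx Sigma *m g i (Y w)))%:E)%E.
  by apply/funext => w; rewrite sumEFin.
rewrite E; split; first by apply: integrable_sum => // i _; have [] := sr i.
rewrite integral_sum//; last by move=> i; have [] := sr i.
under [RHS]eq_integral do rewrite -sumEFin.
rewrite integral_sum//; last first.
  by move=> i; exact: (testfun_integrable P (testfun_mxtrace (nL i)) mY).
by apply: eq_bigr => i _; have [] := sr i.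
Qed.

Lemma expected_quad_le (x : 'cV[R]_p) :
  (\int[P]_w (cfac de ep (Y w) x ^+ 2 *
     dot (vvec de (Y w) x) (invmx Sigma *m vvec de (Y w) x))%:E <=
   \int[P]_w ((p%:R - n%:R + 3 + 4 * de * tikabs de (Y w)) * cfac de ep (Y w) x)%:E)%E.
Proof.
have [iX] := sum_stein_row (testmx_quad_field de0 ep0 x) (testmx_quad_jac de0 ep0 x) (mxderiv0_quad_field de0 ep0 x).
under [X in X = _ -> _]eq_integral do rewrite sum_dot_quad_field.
move=> ->; apply: le_integral => //.
- apply: (testfun_integrable P _ mY (f := fun M => \sum_i \tr (quad_jac de ep x i M))).
  by apply: testfun_sum => i; apply: testfun_mxtrace; exact: testmx_quad_jac.
- apply: (@bounded_integrable _ _ _ _ _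
    ((p%:R - n%:R + 3 + 4 * de * (n%:R * n%:R * de^-1)) * ep^-1)).
    apply: measurable_funM.
      apply: measurable_funD => //; apply: measurable_funM => //.
      exact: (measurableT_comp measurable_tikabs mY).
    by have [mc _ _] := @testfun_cfac R n p de ep de0 ep0 x; exact: (measurableT_comp mc mY).
  move=> w; have np0 : 0 <= p%:R - n%:R :> R by rewrite subr_ge0 ler_nat ltnW.
  have de0' := ltW de0.
  have A0 : 0 <= p%:R - n%:R + 3 + 4 * de * tikabs de (Y w).
    have B0 : 0 <= 4 * de * tikabs de (Y w) by rewrite !mulr_ge0 ?tikabs_ge0.
    by move: np0 B0; lra.
  have c0 := ltW (cfac_gt0 de ep0 (Y w) x).
  rewrite ger0_norm ?mulr_ge0// ler_pM ?cfac_le//.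
  by rewrite lerD2l ler_wpM2l ?mulr_ge0 ?tikabs_le.
- by move=> w _; rewrite lee_fin; exact: sum_tr_quad_jac_le.
Qed.

(** For [n < p], all the terms of [sum_tr_lin_jac] are nonnegative. *)
Lemma expected_tikabs_sqr_le : (0 < n)%N -> (\int[P]_w (de * tikabs de (Y w) ^+ 2)%:E <=
  (n%:R ^+ 2 * \sum_i \sum_j `|invmx Sigma i j|)%:E)%E.
Proof.
move=> n0.
have [iX eX] := sum_stein_row (testmx_lin_field de0) (testmx_lin_jac de0) (mxderiv0_lin_field de0).
set C0 := \sum_i \sum_j _.
have iL : P.-integrable setT (fun w => (\sum_i \tr (lin_jac de i (Y w)))%:E).
  apply: (testfun_integrable P _ mY (f := fun M => \sum_i \tr (lin_jac de i M))).
  by apply: testfun_sum => i; apply: testfun_mxtrace; exact: testmx_lin_jac.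
have h1 : (\int[P]_w (\sum_i \tr (lin_jac de i (Y w)))%:E <= C0%:E)%E.
  rewrite -eX; apply: (@le_trans _ _ (\int[P]_w C0%:E)%E).
    apply: le_integral => //.
    + by apply: (@bounded_integrable _ _ _ _ _ `|C0|).
    + by move=> w _; rewrite lee_fin sum_dot_lin_field_le.
  by rewrite (integral_cst P measurableT C0%:E) [X in (_ * X)%E](@probability_setT _ _ _ P) mule1.
apply: (@le_trans _ _ (\int[P]_w ((n%:R ^+ 2)%:E * (\sum_i \tr (lin_jac de i (Y w)))%:E))%E).
  apply: ge0_le_integral => //.
  - by move=> w _; rewrite lee_fin mulr_ge0 ?(ltW de0)// exprn_ge0// tikabs_ge0.
  - apply/measurable_EFinP; apply: measurable_funM => //.
    by apply: measurable_funX; exact: (measurableT_comp measurable_tikabs mY).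
  - apply/measurable_EFinP; apply: measurable_funM => //.
    by have /measurable_EFinP := measurable_int _ iL.
  - move=> w _; rewrite -EFinM lee_fin sum_tr_lin_jac//.
    have h2 := tikabs_sqr de (Y w) n0; have h3 := tr_tik_ge0 de0 (Y w).
    have d1 : 0 <= p%:R - n%:R - 1 :> R by rewrite -addrA -opprD subr_ge0 natr1 ler_nat.
    rewrite mulrDr [X in X + _]mulrDr.
    have k1 : 0 <= n%:R ^+ 2 * ((p%:R - n%:R - 1) * \tr (tik de (Y w))).
      by rewrite mulr_ge0 ?exprn_ge0// mulr_ge0.
    have k2 : 0 <= n%:R ^+ 2 * (de * \tr (tik de (Y w)) ^+ 2).
      by rewrite mulr_ge0 ?exprn_ge0// mulr_ge0 ?sqr_ge0// ltW.
    have k3 : de * tikabs de (Y w) ^+ 2 <=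
        n%:R ^+ 2 * (de * \tr (tik de (Y w) *m tik de (Y w))).
      by rewrite [leRHS]mulrCA ler_wpM2l ?(ltW de0).
    by move: k1 k2 k3; lra.
rewrite integralZl//.
by rewrite [leRHS]EFinM lee_wpmul2l// lee_fin exprn_ge0.
Qed.

(** Since [2 s m <= 1 + s^2 m^2], the bound on [de m^2], uniform in [de], gives a
    bound on [de m] that vanishes with [s]. *)
Lemma expected_tikabs_le (s : R) : (0 < n)%N -> 0 < s -> de = s ^+ 2 ->
  (\int[P]_w (de * tikabs de (Y w))%:E <=
   (s * (1 + n%:R ^+ 2 * \sum_i \sum_j `|invmx Sigma i j|))%:E)%E.
Proof.
move=> n0 s0 des.
have mm : measurable_fun setT (fun w => tikabs de (Y w)).
  exact: (measurableT_comp measurable_tikabs mY).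
have mm2 : measurable_fun setT (fun w => (de * tikabs de (Y w) ^+ 2)%:E).
  by apply/measurable_EFinP; apply: measurable_funM => //; exact: measurable_funX.
have p0 w : 0 <= de * tikabs de (Y w) ^+ 2.
  by rewrite mulr_ge0 ?(ltW de0)// exprn_ge0// tikabs_ge0.
apply: (@le_trans _ _ (\int[P]_w (s%:E * (1 + (de * tikabs de (Y w) ^+ 2)%:E)))%E).
  apply: ge0_le_integral => //.
  - by move=> w _; rewrite lee_fin mulr_ge0 ?tikabs_ge0// ltW.
  - by apply/measurable_EFinP; exact: measurable_funM.
  - apply: emeasurable_funM => //; exact: emeasurable_funD.
  - move=> w _; rewrite -EFinD -EFinM lee_fin [X in X * tikabs _ _]des [X in _ <= s * (1 + X * _)]des.
    have := tikabs_ge0 de (Y w); move: (tikabs _ _) => m m0.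
    have h : 0 <= s * (1 - s * m) ^+ 2 by rewrite mulr_ge0 ?sqr_ge0// ltW.
    have h' : 0 <= s ^+ 2 * m by rewrite mulr_ge0// exprn_ge0// ltW.
    by move: h h'; lra.
rewrite ge0_integralZl//; last 3 first.
- exact: emeasurable_funD.
- by move=> w _; rewrite -EFinD lee_fin addr_ge0.
- by rewrite lee_fin ltW.
rewrite ge0_integralD//; last by move=> w _; rewrite lee_fin.
rewrite (integral_cst P measurableT 1%E) [X in (1 * X + _)%E](@probability_setT _ _ _ P) mule1.
rewrite [leRHS]EFinM lee_wpmul2l ?lee_fin ?(ltW s0)// EFinD leeD2l//.
exact: expected_tikabs_sqr_le.
Qed.

End quadratic_term.
End expected_divergence.

(** * Pseudo-inverses as limits *)

Section mcvg.
Context {R : realType}.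

Definition mcvg m n (F : nat -> 'M[R]_(m, n)) (L : 'M[R]_(m, n)) : Prop :=
  forall i j, F k i j @[k --> \oo] --> L i j.

Lemma mcvg_cst m n (A : 'M[R]_(m, n)) : mcvg (fun=> A) A.
Proof. by move=> i j; exact: cvg_cst. Qed.

Lemma mcvgD m n (F G : nat -> 'M[R]_(m, n)) A B : mcvg F A -> mcvg G B ->
  mcvg (fun k => F k + G k) (A + B).
Proof.
by move=> hF hG i j; rewrite mxE; under eq_fun do rewrite mxE; exact: cvgD.
Qed.

Lemma mcvgN m n (F : nat -> 'M[R]_(m, n)) A : mcvg F A -> mcvg (fun k => - F k) (- A).
Proof.
by move=> hF i j; rewrite mxE; under eq_fun do rewrite mxE; exact: cvgN.
Qed.

Lemma mcvgZ m n (c : nat -> R) (F : nat -> 'M[R]_(m, n)) (l : R) A :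
  c k @[k --> \oo] --> l -> mcvg F A -> mcvg (fun k => c k *: F k) (l *: A).
Proof.
by move=> hc hF i j; rewrite mxE; under eq_fun do rewrite mxE; exact: cvgM.
Qed.

Lemma mcvgM m n p (F : nat -> 'M[R]_(m, n)) (G : nat -> 'M[R]_(n, p)) A B :
  mcvg F A -> mcvg G B -> mcvg (fun k => F k *m G k) (A *m B).
Proof.
move=> hF hG i j; rewrite mxE; under eq_fun do rewrite mxE.
by apply: cvg_sumr => k _; exact: cvgM.
Qed.

Lemma mcvg_tr m n (F : nat -> 'M[R]_(m, n)) A : mcvg F A -> mcvg (fun k => (F k)^T) A^T.
Proof.
move=> hF i j; rewrite mxE (_ : (fun k => _) = (fun k => F k j i)); first exact: hF.
by apply/funext => k; rewrite mxE.
Qed.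

Lemma mcvg_dot n (F G : nat -> 'cV[R]_n) A B : mcvg F A -> mcvg G B ->
  dot (F k) (G k) @[k --> \oo] --> dot A B.
Proof.
move=> hF hG; have h := mcvgM (mcvg_tr hF) hG.
by have := h 0 0.
Qed.

End mcvg.

Section mpinv_limit.
Context {R : realType} {n p : nat}.
Implicit Types Y : 'M[R]_(n, p).

(** Let [N = (Y^+)'] and [H = N Y^+ N].  Then [Y = Y Y' N] and [N = Y Y' H], whence
    [tik Y *m Y = N - de (H - de tik Y H)], where the entries of [de tik Y] are at
    most 1 in absolute value. *)
Lemma tik_mpinv_bound Y : exists B : 'I_p -> R, forall de : R, 0 < de -> forall i j,
  `|(tik de Y *m Y) i j - (mpinv Y)^T i j| <= de * B j.
Proof.
have [h1 h2 h3 h4] := mpinvP Y.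
set G := mpinv Y in h1 h2 h3 h4 *.
pose N := G^T; pose H := N *m G *m N.
have YN : Y *m Y^T *m N = Y by rewrite -mulmxA -trmx_mul h4 mulmxA.
have NH : N = Y *m Y^T *m H.
  have e1 : G = Y^T *m N *m G by rewrite -trmx_mul h4 h2.
  have e2 : N = Y *m G *m N.
    by rewrite /N -{1}h2 -mulmxA trmx_mul h3.
  by rewrite {1}e2 {1}e1 /H !mulmxA.
pose B j := 2 * \sum_k `|H k j|.
exists B => de de0 i j.
have E : tik de Y *m Y = N - de *: (H - (de *: tik de Y) *m H).
  have t1 (A : 'M[R]_(n, p)) : tik de Y *m (Y *m Y^T *m A) = A - de *: (tik de Y *m A).
    by rewrite mulmxA tik_gram// mulmxBl mul1mx -scalemxAl.
  transitivity (tik de Y *m (Y *m Y^T *m N)); first by rewrite YN.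
  by rewrite t1; congr (_ - _ *: _); rewrite -scalemxAl -t1 -NH.
have ZE (A Z : 'M[R]_(n, p)) : (A - de *: Z) i j - A i j = - (de * Z i j).
  by rewrite !mxE; ring.
rewrite E ZE normrN normrM (gtr0_norm de0) ler_wpM2l ?(ltW de0)// mxE.
rewrite (le_trans (ler_normD _ _))// /B mulr2n mulrDl mul1r lerD//.
  by rewrite (bigD1 i)//= lerDl sumr_ge0.
rewrite mxE normrN mxE (le_trans (ler_norm_sum _ _ _))// ler_sum// => k _.
by rewrite normrM ler_piMl//; exact: scaled_tik_entry.
Qed.

Lemma tik_cvg (de : nat -> R) Y : (forall k, 0 < de k) ->
  de k @[k --> \oo] --> (0 : R) ->
  mcvg (fun k => tik (de k) Y *m Y) (mpinv Y)^T.
Proof.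
move=> de0 dec i j; have [B hB] := tik_mpinv_bound Y.
set N := (mpinv Y)^T in hB *.
apply: (@squeeze_cvgr _ _ _ _ (fun k => N i j - de k * B j)
  (fun k => N i j + de k * B j)).
- by apply: nearW => k; rewrite -ler_distl; exact: hB.
- rewrite -[X in _ --> X]subr0 -[X in _ --> _ - X](mul0r (B j)).
  by apply: cvgB; [exact: cvg_cst|apply: cvgM => //; exact: cvg_cst].
- rewrite -[X in _ --> X]addr0 -[X in _ --> _ + X](mul0r (B j)).
  by apply: cvgD; [exact: cvg_cst|apply: cvgM => //; exact: cvg_cst].
Qed.

End mpinv_limit.

(** The successive values of [de]; squares, in view of [expected_tikabs_le]. *)
Definition inv_sqr (R : realType) (k : nat) : R := k.+1%:R^-1 ^+ 2.

Lemma inv_sqr_gt0 (R : realType) k : 0 < inv_sqr R k.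
Proof. by rewrite exprn_gt0// invr_gt0. Qed.

Lemma cvg_inv_sqr (R : realType) : inv_sqr R k @[k --> \oo] --> (0 : R).
Proof.
rewrite -[X in _ --> X](mulr0 (0 : R)); under eq_fun do rewrite /inv_sqr expr2.
by apply: cvgM; exact: cvg_harmonic.
Qed.

(** Pseudo-inversion is not continuous, but it is a pointwise limit of rational
    functions. *)
Lemma measurable_mpinv (R : realType) n p :
  measurable_fun setT (@mpinv R n p : 'M[R]_(n, p) -> 'M[R]_(p, n)).
Proof.
apply/measurable_mxP => j i.
apply: (measurable_fun_cvg (h := fun k Y => (tik (inv_sqr R k) Y *m Y) i j)).
- by move=> k; have [] := @testmx_tikY R n p _ (inv_sqr_gt0 R k) i j.
- move=> Y _; have := @tik_cvg R n p (inv_sqr R) Y (@inv_sqr_gt0 R) (@cvg_inv_sqr R) i j.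
  by rewrite mxE.
Qed.

Lemma mpinv_gram (R : realFieldType) n p (Y : 'M[R]_(n, p)) :
  mpinv (Y^T *m Y) = mpinv Y *m (mpinv Y)^T.
Proof.
apply: (is_mpinv_unique (mpinvP _)).
have [h1 h2 h3 h4] := mpinvP Y; set G := mpinv Y in h1 h2 h3 h4 *.
have YG : Y^T *m (Y *m G) = Y^T by rewrite -h3 -trmx_mul h1.
have MN : Y^T *m Y *m (G *m G^T) = G *m Y.
  by rewrite !mulmxA -(mulmxA Y^T) YG -trmx_mul h4.
have NM : G *m G^T *m (Y^T *m Y) = G *m Y.
  by rewrite -mulmxA (mulmxA G^T) -trmx_mul h3 !mulmxA h2.
split; rewrite ?MN ?NM ?h4//.
  by rewrite -{1}h4 mulmxA -trmx_mul mulmxA h1.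
by rewrite mulmxA h2.
Qed.

Section gram_estimator.
Context {R : realType} {n p : nat}.

Lemma deltaJS_gram (a : R) (x : 'cV[R]_p) (Y : 'M[R]_(n, p)) :
  let W0 := (mpinv Y)^T *m x in
  deltaJS a x (Y^T *m Y) = x - a *: ((dot W0 W0)^-1 *: (Y^T *m W0)).
Proof.
move=> W0; rewrite /deltaJS mpinv_gram mulmxBl mul1mx; congr (_ - _).
have -> : (x^T *m (mpinv Y *m (mpinv Y)^T) *m x) 0 0 = dot W0 W0.
  by rewrite /dot trmx_mul trmxK !mulmxA.
rewrite -scalemxAl -scalerA; congr (_ *: (_ *: _)).
have [h1 h2 h3 h4] := mpinvP Y; set G := mpinv Y in h1 h2 h3 h4 *.
rewrite /W0 !mulmxA -(mulmxA Y^T) -[X in Y^T *m X]h3 -trmx_mul h1.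
by [].
Qed.
End gram_estimator.

(** * Comparison of the risks *)

Lemma fatou_le_cvg (R : realType) d (T : measurableType d) (mu : {measure set T -> \bar R})
    (f_ : nat -> T -> R) (f : T -> R) (b : R) (u : nat -> R) :
  (forall k, measurable_fun setT (f_ k)) -> (forall k x, 0 <= f_ k x) ->
  (forall x, f_ k x @[k --> \oo] --> f x) -> u k @[k --> \oo] --> (0 : R) ->
  (forall k, (\int[mu]_x (f_ k x)%:E <= (b + u k)%:E)%E) ->
  (\int[mu]_x (f x)%:E <= b%:E)%E.
Proof.
move=> mf f0 ff u0 bnd.
have h : (\int[mu]_x limn_einf (fun k => (f_ k x)%:E) <=
    limn_einf (fun k => \int[mu]_x (f_ k x)%:E))%E.
  apply: (@fatou _ _ _ mu setT measurableT (fun k x => (f_ k x)%:E)).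
    by move=> k; exact/measurable_EFinP.
  by move=> k x _; rewrite lee_fin.
have e : (\int[mu]_x (f x)%:E = \int[mu]_x limn_einf (fun k => (f_ k x)%:E))%E.
  apply: eq_integral => x _; apply/esym.
  have c : (f_ k x)%:E @[k --> \oo] --> (f x)%:E.
    by apply: cvg_EFin; [exact: nearW|exact: ff].
  by rewrite (cvg_limn_einf_sup c).
rewrite e (le_trans h)//.
have bu : (b + u k)%:E @[k --> \oo] --> b%:E.
  apply: cvg_EFin; first exact: nearW.
  by rewrite /= -[X in _ --> X]addr0; apply: cvgD => //; exact: cvg_cst.
rewrite limn_einf_lim -(cvg_lim _ bu)//.
apply: lee_lim; [exact: is_cvg_einfs|by apply/cvg_ex; exists b%:E|].
apply: nearW => k; rewrite (le_trans _ (bnd k))//.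
by apply: ereal_inf_lbound; exists k => /=.
Qed.

(** The counterpart of [integrable_fubini_F] for integration in the other order. *)
Lemma integrable_fubini_G (R : realType) d1 d2 (T1 : measurableType d1)
    (T2 : measurableType d2) (m1 : {sigma_finite_measure set T1 -> \bar R})
    (m2 : {sigma_finite_measure set T2 -> \bar R}) (f : T1 * T2 -> \bar R) :
  (m1 \x m2)%E.-integrable setT f -> m2.-integrable setT (fubini_G m1 f).
Proof.
move=> fi; have mf := measurable_int _ fi.
apply/integrableP; split; first exact: (measurable_fubini_G fi).
have [fy _] := @integrable21ltyP _ _ _ _ _ m1 m2 f mf.
apply: le_lt_trans (fy fi).
apply: ge0_le_integral => //.
- by apply: measurableT_comp => //; exact: (measurable_fubini_G fi).
- apply: (measurable_fun_fubini_tonelli_G (abse \o f)) => //=.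
  exact: measurableT_comp.
- move=> y _; apply: le_abse_integral => //.
  by apply: (measurableT_comp mf); exact: measurable_pair2.
Qed.

Section loss.
Context {R : realType} {p : nat} (Sigma : 'M[R]_p) (theta : 'cV[R]_p).
Hypothesis pS : posdefmx Sigma.

Lemma invmx_sym : (invmx Sigma)^T = invmx Sigma.
Proof. by rewrite trmx_inv; have [-> _] := pS. Qed.

Lemma dot_invmx_ge0 u : 0 <= dot u (invmx Sigma *m u).
Proof.
have uS := posdefmx_unit pS; set t := invmx Sigma *m u.
have -> : u = Sigma *m t by rewrite mulKVmx.
have [t0|t0] := eqVneq t 0; first by rewrite t0 /dot mulmx0 mxE.
have [sS /(_ _ t0)] := pS.
by rewrite -mulmxA => /ltW; rewrite -/(dot _ _) dotC.
Qed.

Lemma lossE de : loss Sigma theta de = dot (de - theta) (invmx Sigma *m (de - theta)).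
Proof. by rewrite /loss -mulmxA. Qed.

Lemma loss_ge0 de : 0 <= loss Sigma theta de.
Proof. by rewrite lossE dot_invmx_ge0. Qed.

Lemma loss_expand a x g : loss Sigma theta (x - a *: g) =
  loss Sigma theta x - 2 * a * dot (x - theta) (invmx Sigma *m g)
  + a ^+ 2 * dot g (invmx Sigma *m g).
Proof.
rewrite !lossE addrAC; set y := x - theta.
have s : dot g (invmx Sigma *m y) = dot y (invmx Sigma *m g).
  by rewrite dotC dot_mull invmx_sym.
rewrite mulmxBr -scalemxAr dotBl !dotBr !dotZl !dotZr s; ring.
Qed.

Lemma measurable_loss d (T : measurableType d) (f : T -> 'cV[R]_p) :
  measurable_fun setT f -> measurable_fun setT (fun w => loss Sigma theta (f w)).
Proof.
move=> mf; rewrite /loss; apply: (measurableT_comp (measurable_mx_entry 0 0)).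
have md : measurable_fun setT (fun w => f w - theta).
  by apply: measurable_mxD => //; exact: measurable_cst.
apply: measurable_mulmx => //; apply: measurable_mulmx; last exact: measurable_cst.
exact: measurable_trmx.
Qed.

Lemma cvg_loss (F : nat -> 'cV[R]_p) A : mcvg F A ->
  loss Sigma theta (F k) @[k --> \oo] --> loss Sigma theta A.
Proof.
move=> hF; rewrite lossE; under eq_fun do rewrite lossE.
have hd : mcvg (fun k => F k - theta) (A - theta).
  by apply: mcvgD => //; exact: mcvg_cst.
by apply: mcvg_dot => //; apply: mcvgM => //; exact: mcvg_cst.
Qed.

End loss.

Section product_space.
Context {R : realType} {n p : nat} (Sigma : 'M[R]_p) (theta : 'cV[R]_p).
Hypotheses (hn : (3 <= n)%N) (np : (n < p)%N) (pS : posdefmx Sigma).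
Context {d d' : measure_display} {T : measurableType d} {T' : measurableType d'}.
Variables (P : probability T R) (P' : probability T' R).
Variables (X : {RV P >-> 'cV[R]_p}) (Y : {RV P' >-> 'M[R]_(n, p)}).
Hypotheses (nX : multinormal P X theta Sigma) (nY : normal_rows P' Y Sigma).
Variable a : R.
Hypotheses (a0 : 0 <= a) (ha : a <= 2 * (n%:R - 2) / (p%:R - n%:R + 3)).
Let Q : probability (T * T')%type R := (P \x P')%E.
Let l0 x := loss Sigma theta x.
Hypothesis il0 : P.-integrable setT (fun w => (l0 (X w))%:E).

Let mX : measurable_fun setT (fun z : T * T' => X z.1).
Proof. by apply: (measurableT_comp (f := X)) => //; exact: measurable_fst. Qed.

Let mY : measurable_fun setT (fun z : T * T' => Y z.2).
Proof. by apply: (measurableT_comp (f := Y)) => //; exact: measurable_snd. Qed.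

Let K := (2 * a + 4 * a ^+ 2) * (1 + n%:R ^+ 2 * \sum_i \sum_j `|invmx Sigma i j|).

Section regularised.
Variables (s ep : R).
Hypotheses (s0 : 0 < s) (ep0 : 0 < ep).
Let de := s ^+ 2.
Let de0 : 0 < de. Proof. by rewrite exprn_gt0. Qed.

Let c (z : T * T') := cfac de ep (Y z.2) (X z.1).
Let m (z : T * T') := tikabs de (Y z.2).
Let ct (z : T * T') := dot (X z.1 - theta) (invmx Sigma *m shrink de ep (Y z.2) (X z.1)).
Let jt (z : T * T') := c z ^+ 2 * dot (vvec de (Y z.2) (X z.1)) (invmx Sigma *m vvec de (Y z.2) (X z.1)).

Let mW : measurable_fun setT (fun z : T * T' => wvec de (Y z.2) (X z.1)).
Proof.
apply: measurable_mulmx => //; apply: measurable_mulmx => //.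
exact: (measurableT_comp (measurable_tik de0) mY).
Qed.

Let mv : measurable_fun setT (fun z : T * T' => vvec de (Y z.2) (X z.1)).
Proof. by apply: measurable_mulmx => //; exact: measurable_trmx. Qed.

Let measurable_dot (f g : T * T' -> 'cV[R]_p) : measurable_fun setT f ->
  measurable_fun setT g -> measurable_fun setT (fun z => dot (f z) (g z)).
Proof.
move=> mf mg; apply: (measurableT_comp (measurable_mx_entry 0 0)).
by apply: measurable_mulmx => //; exact: measurable_trmx.
Qed.

Let mc : measurable_fun setT c.
Proof.
apply: measurable_fun_inv; apply: measurable_funD => //.
apply: (measurableT_comp (measurable_mx_entry 0 0)).
by apply: measurable_mulmx => //; exact: measurable_trmx.
Qed.

Lemma measurable_shrink : measurable_fun setT (fun z : T * T' => shrink de ep (Y z.2) (X z.1)).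
Proof. exact: measurable_mxZ. Qed.

Let mm : measurable_fun setT m.
Proof. exact: (measurableT_comp (measurable_tikabs de0) mY). Qed.

Let mct : measurable_fun setT ct.
Proof.
apply: measurable_dot; first by apply: measurable_mxD => //; exact: measurable_cst.
by apply: measurable_mulmx; [exact: measurable_cst|exact: measurable_shrink].
Qed.

Let mjt : measurable_fun setT jt.
Proof.
apply: measurable_funM; first exact: measurable_funX.
by apply: measurable_dot => //; apply: measurable_mulmx => //; exact: measurable_cst.
Qed.

Let c_bnd z : `|c z| <= ep^-1.
Proof. by rewrite ger0_norm ?cfac_le// ltW// cfac_gt0. Qed.

Let m_bnd z : `|m z| <= n%:R * n%:R * de^-1.
Proof. by rewrite ger0_norm ?tikabs_le// tikabs_ge0. Qed.

Let ic : Q.-integrable setT (fun z => (c z)%:E).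
Proof. exact: (bounded_integrable _ mc c_bnd). Qed.

Let im : Q.-integrable setT (fun z => (m z)%:E).
Proof. exact: (bounded_integrable _ mm m_bnd). Qed.

Let imc : Q.-integrable setT (fun z => (m z * c z)%:E).
Proof. exact: (integrable_bounded_mul im mc c_bnd). Qed.

Let il0Q : Q.-integrable setT (fun z => (l0 (X z.1))%:E).
Proof.
have ml : measurable_fun setT (fun z : T * T' => (l0 (X z.1))%:E).
  by apply/measurable_EFinP; exact: measurable_loss.
apply/integrable12ltyP => //=.
have /integrableP[_] := il0; apply: le_lt_trans; apply: ge0_le_integral => //.
- by move=> w _; apply: integral_ge0.
- exact: (measurable_fun_fubini_tonelli_F (fun z : T * T' => `|(l0 (X z.1))%:E|%E)
    (measurableT_comp (@abse_measurable _ _) ml)).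
- by apply: measurableT_comp => //; exact: measurable_int il0.
- by move=> w _; rewrite (integral_cst P' measurableT `|(l0 (X w))%:E|%E) [X in (_ * X)%E](@probability_setT _ _ _ P') mule1.
Qed.

Let intl0Q : (\int[Q]_z (l0 (X z.1))%:E = \int[P]_w (l0 (X w))%:E)%E.
Proof.
rewrite fubini_tonelli1//=.
- apply: eq_integral => w _ /=.
  rewrite /fubini_F /=.   by rewrite (integral_cst P' measurableT (l0 (X w))%:E) [X in (_ * X)%E](@probability_setT _ _ _ P') mule1.
- by apply/measurable_EFinP; exact: measurable_loss.
- by move=> z; rewrite lee_fin; exact: loss_ge0.
Qed.

Let lower z := (n%:R - 2 - de * m z) * c z.
Let upper z := (p%:R - n%:R + 3 + 4 * de * m z) * c z.

Let pn0 : 0 <= p%:R - n%:R :> R.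
Proof. by rewrite subr_ge0 ler_nat ltnW. Qed.

Let c0 z : 0 <= c z.
Proof. by rewrite ltW// cfac_gt0. Qed.

Let m0 z : 0 <= m z.
Proof. exact: tikabs_ge0. Qed.

Let upper0 z : 0 <= upper z.
Proof.
have : 0 <= 4 * de * m z by rewrite !mulr_ge0// ltW.
by move=> h; rewrite mulr_ge0//; move: pn0 h; lra.
Qed.

Let ilower : Q.-integrable setT (fun z => (lower z)%:E).
Proof.
rewrite (_ : (fun z => _) = (fun z => (n%:R - 2)%:E * (c z)%:E + (- de)%:E * (m z * c z)%:E)%E).
  by apply: integrableD => //; apply: integrableZl.
by apply/funext => z; rewrite -!EFinM -EFinD /lower; congr (_%:E); ring.
Qed.

Let iupper : Q.-integrable setT (fun z => (upper z)%:E).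
Proof.
rewrite (_ : (fun z => _) = (fun z => (p%:R - n%:R + 3)%:E * (c z)%:E +
    (4 * de)%:E * (m z * c z)%:E)%E).
  by apply: integrableD => //; apply: integrableZl.
by apply/funext => z; rewrite -!EFinM -EFinD /upper; congr (_%:E); ring.
Qed.

Let jt0 z : 0 <= jt z.
Proof. by rewrite mulr_ge0 ?exprn_ge0// dot_invmx_ge0. Qed.

(** All is nonnegative, so that Tonelli's theorem applies, and it also shows that the
    quadratic term is integrable. *)
Let jt_upper : (\int[Q]_z (jt z)%:E <= \int[Q]_z (upper z)%:E)%E.
Proof.
have mjt' : measurable_fun setT (fun z => (jt z)%:E) by exact/measurable_EFinP.
have mup : measurable_fun setT (fun z => (upper z)%:E) := measurable_int _ iupper.
rewrite !fubini_tonelli1//; try by move=> z; rewrite lee_fin.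
apply: ge0_le_integral => //.
- by move=> w _; apply: integral_ge0 => w' _; rewrite lee_fin.
- by apply: measurable_fun_fubini_tonelli_F => // z; rewrite lee_fin.
- by apply: measurable_fun_fubini_tonelli_F => // z; rewrite lee_fin.
- by move=> w _; exact: (expected_quad_le de0 ep0 pS nY np (X w)).
Qed.

Let ijt : Q.-integrable setT (fun z => (jt z)%:E).
Proof.
apply/integrableP; split; first exact/measurable_EFinP.
under eq_integral do rewrite gee0_abs ?lee_fin//.
rewrite (le_lt_trans jt_upper)//.
by rewrite integrable_lty.
Qed.

(** [2 * `|ct| <= l0 + jt], for the losses of [x - g] and [x + g] are nonnegative, [g]
    being the shrinkage field. *)
Let ict : Q.-integrable setT (fun z => (ct z)%:E).
Proof.
apply: (@le_integrable _ _ _ Q setT measurableT _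
  (fun z => (l0 (X z.1))%:E + (jt z)%:E)%E); last exact: integrableD.
  exact/measurable_EFinP.
move=> z _; rewrite -EFinD !abse_EFin lee_fin.
rewrite [leRHS]ger0_norm; last by rewrite addr_ge0// loss_ge0.
have jE : dot (shrink de ep (Y z.2) (X z.1)) (invmx Sigma *m shrink de ep (Y z.2) (X z.1)) = jt z.
  by rewrite /shrink -scalemxAr dotZl dotZr mulrA -expr2.
have h1 := loss_ge0 theta pS (X z.1 - 1 *: shrink de ep (Y z.2) (X z.1)).
have h2 := loss_ge0 theta pS (X z.1 - (-1) *: shrink de ep (Y z.2) (X z.1)).
rewrite loss_expand// jE -/(ct z) -/(l0 _) in h1.
rewrite loss_expand// jE -/(ct z) -/(l0 _) in h2.
have h3 : 0 <= l0 (X z.1) by exact: loss_ge0.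
have h4 := jt0 z.
by rewrite ler_norml; apply/andP; split; lra.
Qed.

Let lower_ct : (\int[Q]_z (lower z)%:E <= \int[Q]_z (ct z)%:E)%E.
Proof.
rewrite -!integral21_prod_meas1//.
apply: le_integral => //; try exact: integrable_fubini_G.
move=> w' _; have [_] := expected_cross_ge de0 ep0 pS nX (Y w').
exact.
Qed.

(** The lower bound on the cross term and the upper bound on the quadratic term
    combine into [a (a (p - n + 3) - 2 (n - 2)) c <= 0], up to the error
    [(2 a + 4 a^2) de m c <= (2 a + 4 a^2) de m / ep]. *)
Lemma risk_tik_le : (\int[Q]_z (loss Sigma theta
     (X z.1 - a *: shrink de ep (Y z.2) (X z.1)))%:E <=
   \int[P]_w (l0 (X w))%:E + (s * (K / ep))%:E)%E.
Proof.
have E z : loss Sigma theta (X z.1 - a *: shrink de ep (Y z.2) (X z.1)) =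
    l0 (X z.1) + (- (2 * a)) * ct z + a ^+ 2 * jt z.
  rewrite loss_expand// /l0 /ct mulNr; congr (_ + _ * _).
  by rewrite /shrink -scalemxAr dotZl dotZr mulrA -expr2.
have i1 : Q.-integrable setT (fun z => ((- (2 * a))%:E * (ct z)%:E)%E).
  exact: integrableZl.
have i2 : Q.-integrable setT (fun z => ((a ^+ 2)%:E * (jt z)%:E)%E).
  exact: integrableZl.
have i3 : Q.-integrable setT (fun z => ((- (2 * a))%:E * (lower z)%:E)%E).
  exact: integrableZl.
have i4 : Q.-integrable setT (fun z => ((a ^+ 2)%:E * (upper z)%:E)%E).
  exact: integrableZl.
have i6 : Q.-integrable setT (fun z => (de * m z)%:E).
  rewrite (_ : (fun z => _) = (fun z => de%:E * (m z)%:E)%E).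
    exact: integrableZl.
  by apply/funext => z; rewrite EFinM.
have i5 : Q.-integrable setT (fun z => (((2 * a + 4 * a ^+ 2) / ep)%:E * (de * m z)%:E)%E).
  exact: integrableZl.
apply: (@le_trans _ _ (\int[Q]_z ((l0 (X z.1))%:E +
   ((- (2 * a))%:E * (lower z)%:E + (a ^+ 2)%:E * (upper z)%:E)))%E).
  under eq_integral do rewrite E !EFinD EFinM [((a ^+ 2) * _)%:E]EFinM -addeA.
  rewrite integralD//; last exact: integrableD.
  rewrite [leRHS]integralD//; last exact: integrableD.
  rewrite leeD2l// integralD// [leRHS]integralD// !integralZl//.
  apply: leeD; last by rewrite lee_wpmul2l// lee_fin sqr_ge0.
  rewrite EFinN !mulNe leeN2 lee_wpmul2l// lee_fin mulr_ge0//.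
apply: (@le_trans _ _ (\int[Q]_z ((l0 (X z.1))%:E +
   ((2 * a + 4 * a ^+ 2) / ep)%:E * (de * m z)%:E))%E).
  apply: le_integral => //; [|exact: integrableD|].
    by apply: integrableD => //; exact: integrableD.
  move=> z _; rewrite -!EFinM -!EFinD lee_fin lerD2l.
  have h1 : a * (p%:R - n%:R + 3) <= 2 * (n%:R - 2).
    by rewrite -ler_pdivlMr// ltr_wpDl.
  have h2 : 0 <= c z * (a * (2 * (n%:R - 2) - a * (p%:R - n%:R + 3))).
    by rewrite mulr_ge0// mulr_ge0// subr_ge0.
  have h3 : 0 <= (2 * a + 4 * a ^+ 2) * (de * m z) * (ep^-1 - c z).
    rewrite mulr_ge0 ?subr_ge0 ?cfac_le// mulr_ge0//.
      by rewrite addr_ge0// mulr_ge0// sqr_ge0.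
    by rewrite mulr_ge0// ltW.
  by rewrite /lower /upper; move: h2 h3; lra.
rewrite integralD// intl0Q leeD2l// integralZl//.
have n0 : (0 < n)%N by rewrite (leq_trans _ hn).
have b := expected_tikabs_le de0 pS nY np n0 s0 erefl.
have -> : s * (K / ep) = (2 * a + 4 * a ^+ 2) / ep *
    (s * (1 + n%:R ^+ 2 * \sum_i \sum_j `|invmx Sigma i j|)).
  by rewrite /K; ring.
rewrite [leRHS]EFinM lee_wpmul2l//.
  by rewrite lee_fin mulr_ge0 ?invr_ge0 ?(ltW ep0)// addr_ge0// mulr_ge0// sqr_ge0.
apply: le_trans b.
rewrite fubini_tonelli2//; last 2 first.
- by apply/measurable_EFinP; exact: measurable_funM.
- by move=> z; rewrite lee_fin mulr_ge0// ltW.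
rewrite le_eqVlt; apply/orP; left; apply/eqP; apply: eq_integral => w _.
rewrite /fubini_G /=.
by rewrite (integral_cst P measurableT (de * tikabs de (Y w))%:E) [X in (_ * X)%E](@probability_setT _ _ _ P) mule1.
Qed.

End regularised.

Let I0 := fine (\int[P]_w (l0 (X w))%:E)%E.

Let I0E : (\int[P]_w (l0 (X w))%:E = I0%:E)%E.
Proof. by rewrite fineK// integrable_fin_num. Qed.

Let W0 (z : T * T') := (mpinv (Y z.2))^T *m X z.1.

Let mW0 : measurable_fun setT W0.
Proof.
apply: measurable_mulmx => //; apply: measurable_trmx.
exact: (measurableT_comp (@measurable_mpinv R n p) mY).
Qed.

Let mXg (g : T * T' -> 'cV[R]_p) : measurable_fun setT g ->
  measurable_fun setT (fun z => loss Sigma theta (X z.1 - a *: g z)).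
Proof.
move=> mg; apply: measurable_loss; apply: measurable_mxD => //.
by apply: measurable_mxN; apply: measurable_mxZ => //; exact: measurable_cst.
Qed.

(** Here [de] tends to 0 for a fixed [ep]. *)
Lemma risk_ep_le (ep : R) : 0 < ep ->
  (\int[Q]_z (loss Sigma theta
     (X z.1 - a *: ((dot (W0 z) (W0 z) + ep)^-1 *: ((Y z.2)^T *m W0 z))))%:E <= I0%:E)%E.
Proof.
move=> ep0.
apply: (@fatou_le_cvg _ _ _ _ (fun k z => loss Sigma theta
  (X z.1 - a *: shrink (inv_sqr R k) ep (Y z.2) (X z.1))) _ _ (fun k => k.+1%:R^-1 * (K / ep))).
- move=> k; apply: mXg.
  by apply: measurable_shrink => //; rewrite invr_gt0.
- by move=> k z; exact: loss_ge0.
- move=> z; apply: cvg_loss; apply: mcvgD; first exact: mcvg_cst.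
  have cW : mcvg (fun k => wvec (inv_sqr R k) (Y z.2) (X z.1)) (W0 z).
    apply: mcvgM; last exact: mcvg_cst.
    by apply: tik_cvg; [exact: inv_sqr_gt0|exact: cvg_inv_sqr].
  apply: mcvgN; apply: mcvgZ; first exact: cvg_cst.
  apply: mcvgZ; last by apply: mcvgM => //; exact: mcvg_cst.
  apply: cvgV; first by rewrite gt_eqF// dot_ep_gt0.
  by apply: cvgD; [exact: mcvg_dot|exact: cvg_cst].
- rewrite -[X in _ --> X](mul0r (K / ep)).
  by apply: cvgM; [exact: cvg_harmonic|exact: cvg_cst].
- by move=> k; rewrite EFinD -I0E; apply: risk_tik_le => //; rewrite invr_gt0.
Qed.

(** Finally [ep] tends to 0.  Where [(Y^+)' X = 0], all these estimators are equal to
    [X]. *)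
Lemma risk_deltaJS_gram_le : (\int[Q]_z (loss Sigma theta
    (deltaJS a (X z.1) ((Y z.2)^T *m Y z.2)))%:E <= I0%:E)%E.
Proof.
apply: (@fatou_le_cvg _ _ _ _ (fun k z => loss Sigma theta
  (X z.1 - a *: ((dot (W0 z) (W0 z) + k.+1%:R^-1)^-1 *: ((Y z.2)^T *m W0 z)))) _ _ (fun=> 0)).
- move=> k; apply: mXg; apply: measurable_mxZ; last first.
    by apply: measurable_mulmx => //; exact: measurable_trmx.
  apply: measurable_fun_inv; apply: measurable_funD => //.
  apply: (measurableT_comp (measurable_mx_entry 0 0)).
  by apply: measurable_mulmx => //; exact: measurable_trmx.
- by move=> k z; exact: loss_ge0.
- move=> z; rewrite deltaJS_gram -/(W0 z).
  apply: cvg_loss; apply: mcvgD; first exact: mcvg_cst.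
  apply: mcvgN; apply: mcvgZ; first exact: cvg_cst.
  have [/dot_eq0 W00|W00] := eqVneq (dot (W0 z) (W0 z)) 0.
    rewrite W00 mulmx0 scaler0 => i j; rewrite mxE.
    by under eq_fun do rewrite scaler0 mxE; exact: cvg_cst.
  apply: mcvgZ; last exact: mcvg_cst.
  apply: cvgV => //; rewrite -[X in _ --> X]addr0.
  by apply: cvgD; [exact: cvg_cst|exact: cvg_harmonic].
- exact: cvg_cst.
- by move=> k; rewrite addr0; apply: risk_ep_le; rewrite invr_gt0.
Qed.

End product_space.

Section law_gram.
Context {R : realType} {n p : nat}.
Context {d d' : measure_display} {T : measurableType d} {T' : measurableType d'}.
Variables (P : probability T R) (P' : probability T' R).
Variables (X : {RV P >-> 'cV[R]_p}) (S : {RV P >-> 'M[R]_p}) (Y : {RV P' >-> 'M[R]_(n, p)}).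
Hypothesis ind : independent P X S.
Hypothesis lawS : forall B : set 'M[R]_p, measurable B ->
  P (S @^-1` B) = P' [set w | B ((Y w)^T *m Y w)].

(** [S] and [Y] live on different probability spaces, but only the law of [S] and its
    independence from [X] matter. *)
Lemma integral_law_gram (f : 'cV[R]_p * 'M[R]_p -> \bar R) :
  measurable_fun setT f -> (forall z, 0 <= f z)%E ->
  (\int[P]_w f (X w, S w) =
   \int[(P \x P')%E]_z f (X z.1, (Y z.2)^T *m Y z.2))%E.
Proof.
move=> mf f0.
pose G w := (Y w)^T *m Y w.
have mX : measurable_fun setT (X : T -> 'cV[R]_p) by [].
have mY : measurable_fun setT (Y : T' -> 'M[R]_(n, p)) by [].
have mS : measurable_fun setT (S : T -> 'M[R]_p) by [].
have mG : measurable_fun setT G.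
  by apply: measurable_mulmx => //; exact: measurable_trmx.
pose G_mixin := isMeasurableFun.Build _ _ _ _ _ mG.
pose Gp : {mfun T' >-> 'M[R]_p} := HB.pack G G_mixin.
rewrite (ge0_integral_indep mX mS ind (m1 := distribution P X) (m2 := distribution P' Gp))//.
rewrite [LHS]fubini_tonelli1// [RHS]fubini_tonelli1//; last first.
  apply: (measurableT_comp mf); apply: measurable_fun_pair.
    by apply: (measurableT_comp mX); exact: measurable_fst.
  by apply: (measurableT_comp mG); exact: measurable_snd.
rewrite ge0_integral_distribution//.
- apply: eq_integral => w _; rewrite /= /fubini_F ge0_integral_distribution//.
  by apply: (measurableT_comp mf); exact: measurable_pair1.
- exact: measurable_fun_fubini_tonelli_F.
- by move=> x; apply: integral_ge0.
Qed.

End law_gram.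

Theorem corollary2 (R : realType) (n p : nat) (hn : (3 <= n)%N) (hnp : (n < p)%N)
    (a : R) (ha0 : 0 <= a)
    (ha : a <= 2 * (n%:R - 2) / (p%:R - n%:R + 3)) :
  dominates n (deltaJS (p := p) a) (@delta0 R p).
Proof.
move=> theta Sigma pS d T P X S nX [d' [T' [P' [Y [nY lawS]]]]] ind.
rewrite /risk unlock /delta0.
have mX : measurable_fun setT (X : T -> 'cV[R]_p) by [].
have ml : measurable_fun setT (fun w => (loss Sigma theta (X w))%:E).
  by apply/measurable_EFinP; exact: measurable_loss.
(* Unless the risk of X is infinite, when the bound is trivial, its loss is integrable. *)
have [il0|/negP] := pselect (P.-integrable setT (fun w => (loss Sigma theta (X w))%:E)); last first.
  move=> nil0; rewrite [leRHS](_ : _ = +oo%E) ?leey//.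
  apply/eqP; rewrite -leye_eq leNgt; apply/negP => lt; move/negP: nil0; apply.
  apply/integrableP; split => //.
  by under eq_integral do rewrite gee0_abs ?lee_fin ?loss_ge0//.
pose f (z : 'cV[R]_p * 'M[R]_p) := (loss Sigma theta (deltaJS a z.1 z.2))%:E.
have mf : measurable_fun setT f.
  apply/measurable_EFinP; apply: measurable_loss.
  have m1 : measurable_fun setT (fun z : 'cV[R]_p * 'M[R]_p => z.1) by exact: measurable_fst.
  have m2 : measurable_fun setT (fun z : 'cV[R]_p * 'M[R]_p => z.2) by exact: measurable_snd.
  have m3 : measurable_fun setT (fun z : 'cV[R]_p * 'M[R]_p => mpinv z.2).
    exact: (measurableT_comp (@measurable_mpinv R p p) m2).
  apply: measurable_mulmx => //; apply: measurable_mxD; first exact: measurable_cst.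
  apply: measurable_mxN; apply: measurable_mxZ; last exact: measurable_mulmx.
  apply: measurable_funM => //; apply: measurable_fun_inv.
  apply: (measurableT_comp (measurable_mx_entry 0 0)).
  apply: measurable_mulmx => //; apply: measurable_mulmx => //.
  exact: measurable_trmx.
have f0 z : (0 <= f z)%E by rewrite lee_fin loss_ge0.
have -> : (\int[P]_w (loss Sigma theta (deltaJS a (X w) (S w)))%:E =
  \int[(P \x P')%E]_z f (X z.1, (Y z.2)^T *m Y z.2))%E.
  exact: (integral_law_gram ind lawS mf f0).
have := risk_deltaJS_gram_le hn hnp pS nX nY ha0 ha il0.
by rewrite fineK// integrable_fin_num.
Qed.
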